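(* Let $c(\kappa):=\frac{\kappa+1}{2\sqrt{\kappa}}$ for $\kappa\ge 1$, and let $|\cdot|_\star$ denote any one of the three moduli $|\cdot|$, $|\cdot|_{\mathrm{sym}}$, $|\cdot|_{\mathrm{qsym}}$. (a) Let $\mathcal{H}$ be a complex Hilbert space and let $A_1,\dots,A_m\in\mathcal{B}(\mathcal{H})$ be invertible operators whose condition numbers are $\kappa_1,\dots,\kappa_m$. Then $$|A_1+\cdots+A_m|_\star\le \frac{\kappa_1+1}{2\sqrt{\kappa_1}}\,|A_1|_\star+\cdots+\frac{\kappa_m+1}{2\sqrt{\kappa_m}}\,|A_m|_\star .$$ (b) The coefficient function $c$ is individually sharp for each term: for every $\kappa\ge1$, the coefficient $c(\kappa)$ in front of a term of condition number $\kappa$ cannot be replaced by any smaller constant, even if all the other coefficients are kept unchanged. That is, for every $\kappa\ge 1$ and every real $a<c(\kappa)$ there exist a complex Hilbert space $\mathcal{H}$, an integer $m$, and invertible operators $A_1,\dots,A_m\in\mathcal{B}(\mathcal{H})$ with condition numbers $\kappa_1=\kappa,\kappa_2,\dots,\kappa_m$ such that the inequality $$|A_1+\cdots+A_m|_\star\le a\,|A_1|_\star+\sum_{i=2}^m c(\kappa_i)\,|A_i|_\star$$ fails.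
   Context: Hilbert spaces are nonzero and complex; $\mathcal{B}(\mathcal{H})$ is the space of bounded linear operators on $\mathcal{H}$. The condition number of an invertible $A\in\mathcal{B}(\mathcal{H})$ is $\kappa(A)=\|A\|_\infty\|A^{-1}\|_\infty$, with $\|\cdot\|_\infty$ the operator norm. For $T\in\mathcal{B}(\mathcal{H})$: $|T|=(T^*T)^{1/2}$, $|T|_{\mathrm{sym}}=\frac{|T|+|T^*|}{2}$, $|T|_{\mathrm{qsym}}=\left(\frac{T^*T+TT^*}{2}\right)^{1/2}$. For self-adjoint operators, $X\le Y$ means $Y-X$ is positive. *)

(* Defs.v *)
From HB Require Import structures.
From mathcomp Require Import all_boot all_order all_algebra complex.
From mathcomp Require Import all_classical all_reals all_analysis.

Set Implicit Arguments.
Unset Strict Implicit.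
Unset Printing Implicit Defensive.

Import Order.TTheory GRing.Theory Num.Theory.
Import numFieldNormedType.Exports.

Local Open Scope classical_set_scope.
Local Open Scope ring_scope.
Local Open Scope complex_scope.

(* Nonzero complex Hilbert spaces. `inner` is linear in its first argument and
   conjugate-linear in the second; the norm of a `normedModType R[i]` takes its
   (real, nonnegative) values in R[i]. *)
HB.mixin Record CompleteNormedModule_isHilbert (R : realType) H
    & CompleteNormedModule R[i] H := {
  inner : {dot H for (@Num.conj R[i])} ;
  inner_norm : forall x : H, `|x| ^+ 2 = inner x x ;
  hilbert_nonzero : exists x : H, x != 0
}.

#[short(type="hilbertType")]
HB.structure Definition Hilbert (R : realType) :=
  {H of CompleteNormedModule R[i] H & CompleteNormedModule_isHilbert R H}.

Section BoundedOperators.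
Context {R : realType} (H : hilbertType R).

Definition bounded_linear : {pred H -> H} :=
  mem [set T : H -> H | linear T /\
    exists M : R, forall x, `|T x| <= M%:C * `|x|].

(* B(H) *)
Record bounded_op := BoundedOp {
  bounded_op_fun :> H -> H;
  bounded_op_subproof : bounded_op_fun \in bounded_linear
}.

HB.instance Definition _ := [isSub for bounded_op_fun].
HB.instance Definition _ := [Choice of bounded_op by <:].

Lemma bounded_opP (T : bounded_op) :
  linear T /\ exists M : R, forall x, `|T x| <= M%:C * `|x|.
Proof. by have := bounded_op_subproof T; rewrite inE. Qed.

HB.instance Definition _ (T : bounded_op) :=
  GRing.isLinear.Build R[i] H H *:%R T (proj1 (bounded_opP T)).

Lemma bounded_op_bound (T : bounded_op) :
  exists2 M : R, 0 <= M & forall x, `|T x| <= M%:C * `|x|.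
Proof.
have [_ [M TM]] := bounded_opP T.
exists `|M|; first exact: normr_ge0.
move=> x; apply: le_trans (TM x) _.
by rewrite ler_wpM2r// lecR ler_norm.
Qed.

Lemma bounded_linear_submod : subsemimod_closed bounded_linear.
Proof.
split; first split.
- rewrite inE; split; first by move=> a x y; rewrite scaler0 addr0.
  by exists 0 => x; rewrite normr0 mul0r.
- move=> S T; rewrite !inE => -[lS [M SM]] [lT [N TN]]; split.
    by move=> a x y; rewrite !fctE lS lT scalerDr addrACA.
  exists (M + N) => x; rewrite rmorphD mulrDl.
  by apply: le_trans (ler_normD _ _) _; exact: lerD.
- move=> a T; rewrite !inE => -[lT [M TM]]; split.
    by move=> b x y; rewrite !fctE lT scalerDr !scalerA mulrC.
  exists (complex.Re `|a| * M) => x.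
  have -> : (complex.Re `|a| * M)%:C = `|a| * M%:C.
    by rewrite rmorphM; congr (_ * _); exact/RRe_real/normr_real.
  by rewrite normrZ -mulrA ler_wpM2l.
Qed.

HB.instance Definition _ :=
  GRing.isSubSemiModClosed.Build R[i] (H -> H) bounded_linear
    bounded_linear_submod.
HB.instance Definition _ :=
  [SubChoice_isSubLmodule of bounded_op by <:].

Lemma bounded_op_ext (S T : bounded_op) : S =1 T -> S = T.
Proof. by move=> ST; apply/val_inj/funext. Qed.

Lemma bounded_id : idfun \in bounded_linear.
Proof. by rewrite inE; split=> //; exists 1 => x; rewrite mul1r. Qed.

Lemma bounded_comp (S T : bounded_op) : S \o T \in bounded_linear.
Proof.
rewrite inE; split; first by move=> a x y; rewrite /= !linearP.
have [M M0 SM] := bounded_op_bound S; have [N _ TN] := bounded_op_bound T.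
exists (M * N) => x; rewrite rmorphM -mulrA; apply: le_trans (SM _) _.
by apply: ler_wpM2l (TN x); rewrite lecR.
Qed.

Definition op_one := BoundedOp bounded_id.
Definition op_mul S T := BoundedOp (bounded_comp S T).

Fact op_mulA : associative op_mul.
Proof. by move=> A B C; exact: bounded_op_ext. Qed.
Fact op_mul1l : left_id op_one op_mul.
Proof. by move=> A; exact: bounded_op_ext. Qed.
Fact op_mul1r : right_id op_one op_mul.
Proof. by move=> A; exact: bounded_op_ext. Qed.
Fact op_mulDl : left_distributive op_mul +%R.
Proof. by move=> A B C; exact: bounded_op_ext. Qed.
Fact op_mulDr : right_distributive op_mul +%R.
Proof. by move=> A B C; apply: bounded_op_ext => x; exact: linearD. Qed.
Fact op_one_neq0 : op_one != 0.
Proof.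
have [x x0] := @hilbert_nonzero R H.
by apply: contra_neq x0 => /(congr1 (fun T : bounded_op => T x)).
Qed.

HB.instance Definition _ := GRing.Zmodule_isNzRing.Build bounded_op
  op_mulA op_mul1l op_mul1r op_mulDl op_mulDr op_one_neq0.

Definition op_unit : pred bounded_op :=
  fun A => `[< exists B : bounded_op, B * A = 1 /\ A * B = 1 >].
Definition op_inv (A : bounded_op) : bounded_op :=
  xget A [set B : bounded_op | B * A = 1 /\ A * B = 1].

Fact op_mulVr : {in op_unit, left_inverse 1 op_inv *%R}.
Proof.
move=> A /asboolP[B AB]; rewrite /op_inv.
by case: xgetP => [C _ []//|/(_ B)].
Qed.
Fact op_mulrV : {in op_unit, right_inverse 1 op_inv *%R}.
Proof.
move=> A /asboolP[B AB]; rewrite /op_inv.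
by case: xgetP => [C _ []//|/(_ B)].
Qed.
Fact op_unitP (A B : bounded_op) : B * A = 1 /\ A * B = 1 -> op_unit A.
Proof. by move=> AB; apply/asboolP; exists B. Qed.
Fact op_inv_out : {in [predC op_unit], op_inv =1 id}.
Proof.
move=> A /asboolP nA; rewrite /op_inv.
by case: xgetP => // C _ AC; case: nA; exists C.
Qed.

HB.instance Definition _ := GRing.NzRing_hasMulInverse.Build bounded_op
  op_mulVr op_mulrV op_unitP op_inv_out.

End BoundedOperators.

Section OperatorTheory.
Context {R : realType} {H : hilbertType R}.
Implicit Types S T : bounded_op H.

Definition op_norm T : R :=
  sup [set complex.Re `|T x| | x in [set x : H | `|x| <= 1]].

(* `A^-1` is the bounded inverse when `A \is a GRing.unit` *)
Definition cond_number T : R := op_norm T * op_norm T^-1.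

(* the unique such operator, which exists by the Riesz representation theorem *)
Definition adjoint T : bounded_op H :=
  xget 0 [set S : bounded_op H | forall x y, inner (T x) y = inner x (S y)].

(* `<=` on R[i] forces `inner (T x) x` to be real, so that T is self-adjoint *)
Definition op_positive T := forall x : H, 0 <= inner (T x) x.

Definition op_le S T := op_positive (T - S).

(* for T positive, the unique positive square root of T *)
Definition op_sqrt T : bounded_op H :=
  xget 0 [set S : bounded_op H | op_positive S /\ S * S = T].

Definition op_abs T := op_sqrt (adjoint T * T).

Definition op_abs_sym T := (2^-1 : R[i]) *: (op_abs T + op_abs (adjoint T)).

Definition op_abs_qsym T :=
  op_sqrt ((2^-1 : R[i]) *: (adjoint T * T + T * adjoint T)).

End OperatorTheory.

Variant modulus_kind := Abs | AbsSym | AbsQsym.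

Definition modulus {R : realType} {H : hilbertType R} (k : modulus_kind) :
    bounded_op H -> bounded_op H :=
  match k with
  | Abs => op_abs
  | AbsSym => op_abs_sym
  | AbsQsym => op_abs_qsym
  end.

Definition kappa_coef {R : realType} (kappa : R) : R :=
  (kappa + 1) / (2 * Num.sqrt kappa).

(* Main.v *)
(** Let [A] be invertible, [m = 1 / |A^-1|], [M = |A|], and let [S] be [|A|],
    [|A^*|] or [|A|_qsym]. Then
    [m |x| <= |S x| <= M |x|], hence [m <= S <= M] and [(S - m)(M - S) >= 0].
    AM-GM turns the latter into the Kantorovich-type inequality
      [|S x| |x| <= c(kappa) <S x, x>].
    Part (a) follows from [<|T| x, x> <= |T x| |x| <= sum_i |A_i x| |x|]; the
    symmetric modulus averages this over [T] and its adjoint, and for the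
    quadratic one [x |-> | |T|_qsym x |] is the Euclidean norm of the pair
    [(T x, T^* x) / sqrt 2], hence subadditive in [T].

    For (b) take on C^2 the self-adjoint [A_1 = diag(kappa, 1)] and
    [A_2 = t [[0, 1], [1, 0]]], for which the three moduli coincide, and the
    vector [x = (1, sqrt kappa)], which is extremal in the Kantorovich inequality
    for [A_1] and satisfies [A_1 x = sqrt kappa V x], [V] being the swap.
    As [t] tends to infinity,
      [<|A_1 + A_2| x, x> = t |x|^2 + sqrt kappa |x|^2 + O(1/t)],
    while the right-hand side is [a <|A_1| x, x> + t |x|^2]. *)

From HB Require Import structures.
Require Import Defs.
From mathcomp Require Import all_boot all_order all_algebra complex.
From mathcomp Require Import all_classical all_reals all_analysis.
From mathcomp Require Import ring lra.

Set Implicit Arguments.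
Unset Strict Implicit.
Unset Printing Implicit Defensive.

Import Order.TTheory GRing.Theory Num.Theory.
Import numFieldNormedType.Exports.

Local Open Scope classical_set_scope.
Local Open Scope ring_scope.
Local Open Scope complex_scope.

(** * The underlying real inner product *)

(** The discriminant criterion behind [form_cs], the first-variation estimate in [riesz_adjoint] and
    the triangle inequality on C^2. *)
Lemma discriminant_le (R : realFieldType) (a b c : R) :
  (forall t, 0 <= a + 2 * t * b + t ^+ 2 * c) -> b ^+ 2 <= a * c.
Proof.
move=> P; have a0 : 0 <= a by have := P 0; lra.
have [c0|c0|c0] := ltgtP c 0.
(* Adding the values at [s] and [- s] cancels the linear term and leaves [0 <= a + s ^+ 2 * c]; but
   [1 < s] and [s * c] is below [- a]. *)
- exfalso; have := P ((a + 1 + `|b|) / c * (-2) + 1).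
  have := P (- ((a + 1 + `|b|) / c * (-2) + 1)).
  set s := (a + 1 + `|b|) / c * (-2) + 1 => h1 h2.
  have sc : s * c = (a + 1 + `|b|) * (-2) + c by rewrite /s; field; lra.
  have s1 : 1 < s.
    rewrite /s ltrDr -mulrA mulr_gt0 //; first by have := normr_ge0 b; lra.
    by rewrite mulrC nmulr_rgt0 ?invr_lt0 //; lra.
  have := normr_ge0 b; nra.
- have e := P (- b / c).
  have : 0 <= (a + 2 * (- b / c) * b + (- b / c) ^+ 2 * c) * c by apply: mulr_ge0 => //; lra.
  suff -> : (a + 2 * (- b / c) * b + (- b / c) ^+ 2 * c) * c = a * c - b ^+ 2 by lra.
  by field; lra.
- have b0 : b = 0; last by rewrite b0; subst c; lra.
  apply/eqP/negPn/negP => bn.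
  have := P (- (a + 1) / (2 * b)); rewrite c0 mulr0 addr0.
  suff -> : a + 2 * (- (a + 1) / (2 * b)) * b = -1 by lra.
  by field.
Qed.

Lemma ReD (R : realType) (u v : R[i]) :
  complex.Re (u + v) = complex.Re u + complex.Re v.
Proof. by case: u; case: v. Qed.

Lemma ReM_real (R : realType) (a : R) (v : R[i]) :
  complex.Re (a%:C * v) = a * complex.Re v.
Proof. by case: v => u v /=; rewrite mul0r subr0. Qed.

Section RealInner.
Context {R : realType} {H : hilbertType R}.
Implicit Types (x y z : H) (S T : bounded_op H).

Definition rdot x y : R := complex.Re (inner x y).
Definition rnm x : R := complex.Re `|x|.

Lemma opD T x y : T (x + y) = T x + T y. Proof. exact: linearD. Qed.

Lemma opZ T (a : R[i]) x : T (a *: x) = a *: T x. Proof. exact: linearZ. Qed.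

Lemma normE x : `|x| = (rnm x)%:C.
Proof. by rewrite /rnm RRe_real// normr_real. Qed.

Lemma rnm_ge0 x : 0 <= rnm x.
Proof. by have := normr_ge0 x; rewrite normE lecR. Qed.

Lemma rnm_sq x : rnm x ^+ 2 = rdot x x.
Proof. by rewrite /rdot -inner_norm normE -rmorphXn. Qed.

Lemma inner_conj x y : inner x y = (inner y x)^*%C.
Proof. by rewrite hermC expr0 mul1r. Qed.

Lemma innerZl (a : R[i]) x y : inner (a *: x) y = a * inner x y.
Proof. exact: linearZl. Qed.

Lemma innerZr (a : R[i]) x y : inner x (a *: y) = a^*%C * inner x y.
Proof. exact: linearZr. Qed.

Lemma innerDl x y z : inner (x + y) z = inner x z + inner y z.
Proof. exact: linearDl. Qed.

Lemma innerDr x y z : inner x (y + z) = inner x y + inner x z.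
Proof. exact: linearDr. Qed.

Lemma rdotC x y : rdot x y = rdot y x.
Proof. by rewrite /rdot inner_conj; case: (inner y x). Qed.

Lemma rdotDl x y z : rdot (x + y) z = rdot x z + rdot y z.
Proof. by rewrite /rdot linearDl ReD. Qed.

Lemma rdotZl (a : R) x y : rdot (a%:C *: x) y = a * rdot x y.
Proof. by rewrite /rdot linearZl ReM_real. Qed.

Lemma rdotDr x y z : rdot z (x + y) = rdot z x + rdot z y.
Proof. by rewrite !(rdotC z) rdotDl. Qed.

Lemma rdotZr (a : R) x y : rdot y (a%:C *: x) = a * rdot y x.
Proof. by rewrite !(rdotC y) rdotZl. Qed.

Lemma rdotNl x y : rdot (- x) y = - rdot x y.
Proof. by have := rdotZl (-1) x y; rewrite rmorphN1 scaleN1r mulN1r. Qed.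

Lemma rdotNr x y : rdot x (- y) = - rdot x y.
Proof. by rewrite !(rdotC x) rdotNl. Qed.

Lemma rdot0l x : rdot 0 x = 0.
Proof. by have := rdotZl 0 0 x; rewrite mul0r scaler0. Qed.

Lemma rdot0r x : rdot x 0 = 0. Proof. by rewrite rdotC rdot0l. Qed.

Lemma rdot_suml (I : Type) (r : seq I) (P : pred I) (F : I -> H) y :
  rdot (\sum_(i <- r | P i) F i) y = \sum_(i <- r | P i) rdot (F i) y.
Proof.
by apply: (big_morph (rdot^~ y)) => [u v|]; rewrite ?rdotDl ?rdot0l.
Qed.

Lemma rnm_eq0 x : rnm x = 0 -> x = 0.
Proof. by move=> x0; apply/normr0_eq0; rewrite normE x0. Qed.

Lemma rnm0 : rnm 0 = 0. Proof. by rewrite /rnm normr0. Qed.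

Lemma rnmD x y : rnm (x + y) <= rnm x + rnm y.
Proof. by have := ler_normD x y; rewrite !normE -rmorphD lecR. Qed.

Lemma rnmN x : rnm (- x) = rnm x. Proof. by rewrite /rnm normrN. Qed.

Lemma rnmB x y : rnm (x - y) <= rnm x + rnm y.
Proof. by have := rnmD x (- y); rewrite rnmN. Qed.

Lemma rnmBC x y : rnm (x - y) = rnm (y - x).
Proof. by rewrite -rnmN opprB. Qed.

Lemma rnmZ (a : R) x : rnm (a%:C *: x) = `|a| * rnm x.
Proof.
rewrite /rnm normrZ !normE.
have -> : `|a%:C| = `|a|%:C by rewrite normc_def /= expr0n addr0 sqrtr_sqr.
by rewrite -rmorphM.
Qed.

Lemma rnm_sum (I : Type) (r : seq I) (P : pred I) (F : I -> H) :
  rnm (\sum_(i <- r | P i) F i) <= \sum_(i <- r | P i) rnm (F i).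
Proof.
elim/big_rec2: _ => [|i u v _ h]; first by rewrite rnm0.
by apply: le_trans (rnmD _ _) _; rewrite lerD2l.
Qed.

(** Conjugate-linearity gives [inner x ('i *: y) = - 'i * inner x y], whose real part is the
    imaginary part of [inner x y]. *)
Lemma innerE x y : inner x y = rdot x y +i* rdot x ('i *: y).
Proof.
rewrite /rdot innerZr; case: (inner x y) => a b /=.
by congr (_ +i* _); rewrite mul0r sub0r mulN1r opprK.
Qed.

Lemma rdot_inj x y : (forall z, rdot z x = rdot z y) -> x = y.
Proof.
move=> xy; apply/eqP; rewrite -subr_eq0; apply/eqP/rnm_eq0.
by apply/eqP; rewrite -sqrf_eq0 rnm_sq rdotDr rdotNr xy subrr.
Qed.

(** Symmetry for the real form; as [T] is complex-linear, replacing [y] by ['i *: y] shows that this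
    is self-adjointness. *)
Definition selfadj T := forall x y, rdot (T x) y = rdot x (T y).

Lemma positive_rdot T : op_positive T -> forall x, 0 <= rdot (T x) x.
Proof. by move=> Tp x; have := Tp x; rewrite lecE /= => /andP[]. Qed.

(** Polarization: the quadratic form is real at [x], [y], [x + y] and [x + 'i *: y], which forces
    the cross terms to match. *)
Lemma positive_selfadj T : op_positive T -> selfadj T.
Proof.
move=> Tp.
have c0 x : inner (T x) x = inner x (T x).
  rewrite [RHS]inner_conj; have := Tp x; rewrite lecE /= => /andP[/eqP].
  by case: (inner (T x) x) => a b /= ->; rewrite oppr0.
move=> x y; rewrite /rdot.
have h1 := c0 (x + y); have h2 := c0 (x + 'i *: y).
move: h1 h2; rewrite !opD !opZ !innerDl !innerDr !innerZl !innerZr /=.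
rewrite !c0.
move: (inner (T x) y) (inner (T y) x) (inner x (T y)) (inner y (T x))
  (inner x (T x)) (inner y (T y)).
move=> [a a'] [b b'] [c c'] [d d'] [e e'] [f f'] [h1 h1'] [h2 h2'] /=.
lra.
Qed.

Lemma selfadj_positive T : selfadj T -> (forall x, 0 <= rdot (T x) x) ->
  op_positive T.
Proof.
move=> Ts Tp x; rewrite innerE lecE /= Tp andbT.
(* This is the imaginary part of [inner (T x) x]; moving [T] and then ['i] to the other side changes
   its sign. *)
have : rdot (T x) ('i *: x) = - rdot (T x) ('i *: x); last by move=> h; apply/eqP; lra.
rewrite {1}Ts opZ rdotC /rdot innerZl innerZr.
by case: (inner _ _) => a b /=; lra.
Qed.

Lemma form_cs T : selfadj T -> (forall x, 0 <= rdot (T x) x) ->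
  forall x y, rdot (T x) y ^+ 2 <= rdot (T x) x * rdot (T y) y.
Proof.
move=> Ts Tp x y; apply: discriminant_le => t.
have := Tp (x + t%:C *: y); rewrite opD opZ !rdotDl !rdotDr !rdotZl !rdotZr.
by rewrite (Ts y x) (rdotC y); lra.
Qed.

Lemma rdot_cs x y : rdot x y <= rnm x * rnm y.
Proof.
have h : rdot x y ^+ 2 <= (rnm x * rnm y) ^+ 2.
  by rewrite exprMn !rnm_sq; apply: (@form_cs 1) => // z /=; rewrite -rnm_sq sqr_ge0.
have := mulr_ge0 (rnm_ge0 x) (rnm_ge0 y) => p.
by have [|] := lerP (rdot x y) 0; [lra|nra].
Qed.

Lemma rdot_cs_abs x y : `|rdot x y| <= rnm x * rnm y.
Proof. by rewrite ler_norml rdot_cs andbT lerNl -rdotNl -(rnmN x) rdot_cs. Qed.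

Lemma rnm_le (c : R) x : 0 <= c -> rdot x x <= c ^+ 2 -> rnm x <= c.
Proof. by move=> c0; rewrite -rnm_sq ler_sqr ?nnegrE// rnm_ge0. Qed.

Lemma op_bound T : exists2 M : R, 0 <= M & forall x, rnm (T x) <= M * rnm x.
Proof.
have [M M0 h] := bounded_op_bound T; exists M => // x.
by have := h x; rewrite !normE -rmorphM lecR.
Qed.

Lemma hilbert_cauchy (u : nat -> H) :
  (forall e : R, 0 < e -> exists N, forall m n, (N <= m)%N -> (N <= n)%N ->
     rnm (u m - u n) < e) ->
  exists l, forall e : R, 0 < e -> exists N, forall n, (N <= n)%N ->
     rnm (u n - l) < e.
Proof.
move=> cu; have : cauchy (u @ \oo).
  apply: cauchy_exP => e e0.
  (* A positive element of [R[i]] is real, so the radius can be taken in [R]. *)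
  have [r re] : exists r : R, e = r%:C.
    by apply/complex_realP; apply: gtr0_real.
  subst e; have r0 : 0 < r by rewrite -ltcR.
  have [N hN] := cu r r0; exists (u N); exists N => // n /= Nn.
  by rewrite -ball_normE /= normE ltcR; apply: hN.
move=> /cauchy_cvgP /cvg_ex[l /cvgrPdist_lt ul]; exists l => e e0.
have [|N _ hN] := ul e%:C; first by rewrite ltcR.
by exists N => n /hN /=; rewrite normE ltcR rnmBC.
Qed.

End RealInner.

(** * Adjoints *)

Lemma ler_norm_sqr (R : rcfType) (a b : R) :
  0 <= b -> a ^+ 2 <= b ^+ 2 -> `|a| <= b.
Proof.
by move=> b0 ab; rewrite -sqrtr_sqr -(ger0_norm b0) -(sqrtr_sqr b) ler_wsqrtr.
Qed.

Section Operators.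
Context {R : realType} {H : hilbertType R}.
Implicit Types (x y z : H) (S T : bounded_op H).

Lemma opDE S T x : (S + T) x = S x + T x. Proof. by []. Qed.
Lemma opNE S x : (- S) x = - S x. Proof. by []. Qed.
Lemma opZE (a : R[i]) S x : (a *: S) x = a *: S x. Proof. by []. Qed.
Lemma opME S T x : (S * T) x = S (T x). Proof. by []. Qed.
Lemma op1E x : (1 : bounded_op H) x = x. Proof. by []. Qed.

Lemma op_sumE (I : Type) (r : seq I) (P : pred I) (F : I -> bounded_op H) x :
  (\sum_(i <- r | P i) F i) x = \sum_(i <- r | P i) F i x.
Proof. by apply: (big_morph (fun T : bounded_op H => T x)). Qed.

Lemma bounded_op_exists (f : H -> H) (M : R) : linear f ->
  (forall x, rnm (f x) <= M * rnm x) -> exists T : bounded_op H, T =1 f.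
Proof.
move=> lf bf.
have fb : f \in bounded_linear (H := H).
  by rewrite inE; split => //; exists M => x; rewrite !normE -rmorphM lecR.
by exists (BoundedOp fb).
Qed.

(* [z] minimises [|z|^2 - 2 <T z, y>]; the parallelogram identity makes
   minimising sequences Cauchy. *)
Lemma riesz_adjoint T y : exists z, forall x, rdot (T x) y = rdot x z.
Proof.
have [M M0 TM] := op_bound T.
pose J z : R := rdot z z - 2 * rdot (T z) y.
have J_bound z : - (M * rnm y) ^+ 2 <= J z.
  have := rdot_cs (T z) y; have := ler_wpM2r (rnm_ge0 y) (TM z).
  rewrite /J -rnm_sq; have := sqr_ge0 (rnm z - M * rnm y); lra.
pose A := range J.
have A0 : A (J 0) by exists 0.
have Ainf : has_inf A.
  by split; [exists (J 0)|exists (- (M * rnm y) ^+ 2) => _ [z _ <-]].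
have JI z : inf A <= J z by apply: ge_inf; [exact: Ainf.2|exists z].
have approx n : exists z, J z < inf A + n.+1%:R^-1.
  have [_ [z _ <-] hz] := inf_adherent (harmonic_gt0 n) Ainf.
  by exists z.
have /choice[u Ju] := approx.
have par z w : rdot (z - w) (z - w) <= 2 * (J z - inf A) + 2 * (J w - inf A).
  have := JI ((2^-1)%:C *: (z + w)); rewrite /J opZ opD.
  rewrite !(rdotDl, rdotDr, rdotZl, rdotZr, rdotNl, rdotNr) (rdotC w z); lra.
(* A near-minimiser is nearly stationary: [J (z + t x) - inf A] is a nonnegative quadratic
   polynomial in [t], and half its linear coefficient is [rdot z x - rdot (T x) y]. *)
have dir x z : (rdot z x - rdot (T x) y) ^+ 2 <= (J z - inf A) * rdot x x.
  apply: discriminant_le => t.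
  have := JI (z + t%:C *: x); rewrite /J opD opZ.
  rewrite !(rdotDl, rdotDr, rdotZl, rdotZr) (rdotC x z); lra.
have small (e : R) : 0 < e -> exists N, forall n, (N <= n)%N -> J (u n) - inf A < e.
  move=> e0; have [N _ hN] := near_infty_natSinv_lt (PosNum e0).
  by exists N => n /hN /= ?; rewrite ltrBlDl (lt_trans (Ju n))// ltrD2l.
have [e e0|l ul] := hilbert_cauchy (u := u).
  (* [par] doubles each of the two gaps, so gaps below [e ^+ 2 / 4] give a squared distance below
     [e ^+ 2]. *)
  have [|N hN] := small (e ^+ 2 / 4); first by rewrite divr_gt0 ?exprn_gt0.
  exists N => m n Nm Nn.
  have := par (u m) (u n); have := hN _ Nm; have := hN _ Nn.
  rewrite -rnm_sq => h1 h2 h3; have : rnm (u m - u n) ^+ 2 < e ^+ 2 by lra.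
  by rewrite ltr_sqr ?nnegrE ?rnm_ge0 ?ltW.
exists l => x; apply/eqP; rewrite eq_sym -subr_eq0 -normr_le0 leNgt.
apply/negP => D0; set D := `|_| in D0; have x0 := rnm_ge0 x.
(* [D] is at most the sum of two errors, each at most [d * rnm x], whereas
   [D = 4 * d * (rnm x + 1)]. *)
pose d := D / (4 * (rnm x + 1)).
have d0 : 0 < d by rewrite divr_gt0 // mulr_gt0 //; lra.
have [N1 h1] := small (d ^+ 2) (exprn_gt0 2 d0); have [N2 h2] := ul d d0.
have := h1 _ (leq_maxl N1 N2); have := h2 _ (leq_maxr N1 N2).
move: (u (maxn N1 N2)) => z zl zJ.
have : `|rdot z x - rdot (T x) y| <= d * rnm x.
  apply: ler_norm_sqr; first by rewrite mulr_ge0 ?(ltW d0).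
  apply: le_trans (dir x z) _; rewrite exprMn rnm_sq ler_wpM2r// -?rnm_sq ?sqr_ge0//.
  exact: ltW.
have : `|rdot (z - l) x| <= d * rnm x.
  by apply: le_trans (rdot_cs_abs _ _) _; rewrite ler_wpM2r // ltW.
have : D <= `|rdot z x - rdot (T x) y| + `|rdot (z - l) x|.
  rewrite /D (rdotC x l); apply: le_trans (ler_normB _ _); rewrite rdotDl rdotNl.
  by rewrite le_eqVlt; apply/orP; left; apply/eqP; congr (`|_|); lra.
have De : D = d * (4 * (rnm x + 1)) by rewrite /d; field; lra.
rewrite {1}De; nra.
Qed.

Lemma adjoint_exists T :
  exists S : bounded_op H, forall x y, inner (T x) y = inner x (S y).
Proof.
have /choice[f fP] := riesz_adjoint T.
have fC x y : inner (T x) y = inner x (f y).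
  (* The real identity at ['i *: x] supplies the imaginary part of the complex one. *)
  have fi : rdot (T ('i *: x)) y = rdot ('i *: x) (f y) by exact: fP.
  move: (fP y x) fi; rewrite /rdot opZ !innerZl.
  by case: (inner (T x) y) (inner x (f y)) => a b [c d] /= -> h; congr (_ +i* _); lra.
have lf : linear f.
  move=> a x y; apply: rdot_inj => z.
  by rewrite rdotDr /rdot -fC innerDr !innerZr ReD -!fC.
have [M M0 TM] := op_bound T.
(* Boundedness: [|f x|^2 = <T (f x), x> <= M |f x| |x|], then divide by [|f x|]. *)
have [x|S Sf] := bounded_op_exists (M := M) lf.
  have := fP x (f x); rewrite -rnm_sq => h.
  have := rdot_cs (T (f x)) x; rewrite h => h1.
  have := ler_wpM2r (rnm_ge0 x) (TM (f x)) => h2.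
  have [f0|f0] := ltP 0 (rnm (f x)); last by rewrite (le_trans f0) ?mulr_ge0 ?rnm_ge0.
  by rewrite -(ler_pM2l f0) -expr2; apply: le_trans h1 _;
     apply: le_trans h2 _; rewrite mulrCA mulrA.
by exists S => x y; rewrite Sf.
Qed.

Lemma adjointP T x y : inner (T x) y = inner x (adjoint T y).
Proof.
rewrite /adjoint; case: xgetP => [S _ ->//|].
by have [S hS] := adjoint_exists T => /(_ S).
Qed.

Lemma adjoint_rdot T x y : rdot (T x) y = rdot x (adjoint T y).
Proof. by rewrite /rdot adjointP. Qed.

Lemma adjoint_uniq T S : (forall x y, rdot (T x) y = rdot x (S y)) ->
  adjoint T = S.
Proof.
by move=> TS; apply: bounded_op_ext => y; apply: rdot_inj => x; rewrite -adjoint_rdot.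
Qed.

Lemma adjointK T : adjoint (adjoint T) = T.
Proof. by apply: adjoint_uniq => x y; rewrite rdotC -adjoint_rdot rdotC. Qed.

Lemma adjointM S T : adjoint (S * T) = adjoint T * adjoint S.
Proof. by apply: adjoint_uniq => x y; rewrite !opME !adjoint_rdot. Qed.

Lemma adjoint1 : adjoint 1 = 1 :> bounded_op H.
Proof. by apply: adjoint_uniq. Qed.

Lemma adjoint_sum (I : Type) (r : seq I) (P : pred I) (F : I -> bounded_op H) :
  adjoint (\sum_(i <- r | P i) F i) = \sum_(i <- r | P i) adjoint (F i).
Proof.
apply: (big_morph (@adjoint R H)) => [S T|]; apply: adjoint_uniq => x y.
  by rewrite !opDE rdotDl rdotDr !adjoint_rdot.
by rewrite rdot0l rdot0r.
Qed.

Lemma adjoint_bound T (M : R) : 0 <= M -> (forall x, rnm (T x) <= M * rnm x) ->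
  forall x, rnm (adjoint T x) <= M * rnm x.
Proof.
move=> M0 TM x; set y := adjoint T x.
have h : rnm y ^+ 2 <= M * rnm y * rnm x.
  rewrite rnm_sq -adjoint_rdot; apply: le_trans (rdot_cs _ _) _.
  by rewrite ler_wpM2r ?rnm_ge0.
have [y0|y0] := ltP 0 (rnm y); last by rewrite (le_trans y0) ?mulr_ge0 ?rnm_ge0.
by rewrite -(ler_pM2l y0) -expr2 (le_trans h)// mulrCA mulrA.
Qed.
End Operators.

(** * The Kantorovich inequality *)

Section Positive.
Context {R : realType} {H : hilbertType R}.
Implicit Types (x y z : H) (S T : bounded_op H).

(** Cauchy-Schwarz for the form of [T] at [x] and [T x] gives [|T x|^4 <= <T x, x> <T (T x), T x> <=
    d <T x, x> |T x|^2]; divide by [|T x|^2]. *)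
Lemma positive_sq_le T (d : R) : 0 <= d -> op_positive T ->
  (forall x, rdot (T x) x <= d * rdot x x) ->
  forall x, rdot (T x) (T x) <= d * rdot (T x) x.
Proof.
move=> d0 Tp Td x.
have := form_cs (positive_selfadj Tp) (positive_rdot Tp) x (T x).
have := Td (T x); have p := positive_rdot Tp x.
have : 0 <= rdot (T x) (T x) by rewrite -rnm_sq sqr_ge0.
set q := rdot (T x) (T x); rewrite le_eqVlt => /orP[/eqP <- _ _|q0 h1 h2].
  by rewrite mulr_ge0.
rewrite -(ler_pM2r q0) -expr2 (le_trans h2)//.
by rewrite -mulrA mulrCA ler_wpM2l.
Qed.

Lemma rdot_bound T (M : R) x : rnm (T x) <= M * rnm x -> rdot (T x) x <= M * rdot x x.
Proof.
move=> h; apply: le_trans (rdot_cs _ _) _.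
by rewrite -rnm_sq expr2 mulrA ler_wpM2r ?rnm_ge0.
Qed.

Lemma positive_sub T (m : R) : op_positive T ->
  (forall x, m * rdot x x <= rdot (T x) x) -> op_positive (T - m%:C *: (1 : bounded_op H)).
Proof.
move=> Tp Tm; have Ts := positive_selfadj Tp.
apply: selfadj_positive => [x y|x]; rewrite !opDE !opNE !opZE !op1E.
  by rewrite rdotDl rdotDr rdotNl rdotNr rdotZl rdotZr Ts.
by rewrite rdotDl rdotNl rdotZl subr_ge0.
Qed.

(* Let [mu] be the largest constant with [mu <= T]. If [<T x, x>] is close to
   [mu |x|^2], then [T x] is close to [mu x] by [positive_sq_le], so [m <= mu]. *)
Lemma positive_below T (m : R) : op_positive T ->
  (forall x, m * rnm x <= rnm (T x)) -> forall x, m * rdot x x <= rdot (T x) x.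
Proof.
move=> Tp Tm; have [M M0 TM] := op_bound T.
have [x0 x0n] := @hilbert_nonzero R H.
have pos x : x != 0 -> 0 < rdot x x.
  move=> xn; rewrite -rnm_sq exprn_gt0// lt_def rnm_ge0 andbT.
  by apply: contra_neq xn => /rnm_eq0.
pose A := [set c : R | forall x, c * rdot x x <= rdot (T x) x].
have A0 : A 0 by move=> x; rewrite mul0r positive_rdot.
have Asup : has_sup A.
  split; [by exists 0|exists M => c Ac]; rewrite -(ler_pM2r (pos _ x0n)).
  exact: le_trans (Ac _) (rdot_bound (TM _)).
have Amu : A (sup A).
  move=> x; have [->|/pos xp] := eqVneq x 0; first by rewrite !rdot0r mulr0.
  rewrite -ler_pdivlMr//; apply: ge_sup; first by exists 0.
  by move=> c Ac; rewrite ler_pdivlMr.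
have mu0 : 0 <= sup A by exact: ub_le_sup Asup.2 _ A0.
have [mle x|mlt] := lerP m (sup A).
  by apply: le_trans (Amu x); rewrite ler_wpM2r // -rnm_sq sqr_ge0.
exfalso; set mu := sup A in Amu mu0 mlt *.
(* For [x] with [<T x, x> < (mu + e) |x|^2], [positive_sq_le] applied to [T - mu] with [d = M + 1]
   gives [|T x - mu x|^2 <= (M + 1) e |x|^2], which is half of the lower bound
   [(m - mu)^2 |x|^2]. *)
pose e := (m - mu) ^+ 2 / (2 * (M + 1)).
have e0 : 0 < e by rewrite divr_gt0 ?exprn_gt0 ?subr_gt0//; lra.
(* Otherwise [mu + e] would belong to [A] and exceed its supremum. *)
have [x] : exists x, rdot (T x) x < (mu + e) * rdot x x.
  apply/not_existsP => h; suff : mu + e <= mu by lra.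
  by apply: ub_le_sup Asup.2 _ _ => x; rewrite leNgt; apply/negP/h.
move=> hx; have xn : x != 0 by apply: contraTneq hx => ->; rewrite !rdot0r mulr0 ltxx.
have xp := pos _ xn.
have Mp : 0 <= M + 1 by lra.
have := positive_sq_le Mp (positive_sub Tp Amu) _ x.
rewrite !opDE !opNE !opZE !op1E => /(_ _)/wrap[y|].
  rewrite !opDE !opNE !opZE !op1E rdotDl rdotNl rdotZl.
  have := rdot_bound (TM y); have : 0 <= rdot y y by rewrite -rnm_sq sqr_ge0.
  nra.
rewrite -[X in X <= _]rnm_sq rdotDl rdotNl rdotZl.
have : (m - mu) * rnm x <= rnm (T x - mu%:C *: x).
  have := rnmD (T x - mu%:C *: x) (mu%:C *: x).
  by rewrite subrK rnmZ ger0_norm // => h; have := Tm x; lra.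
set Y := rnm (_ - _) => hY hY2.
have h3 : ((m - mu) * rnm x) ^+ 2 <= Y ^+ 2.
  have a0 : 0 <= (m - mu) * rnm x by rewrite mulr_ge0 ?rnm_ge0 // subr_ge0 ltW.
  have Y0 : 0 <= Y by exact: rnm_ge0.
  by rewrite ler_sqr ?nnegrE.
have ee : (m - mu) ^+ 2 = e * (2 * (M + 1)) by rewrite /e; field; lra.
rewrite exprMn ee rnm_sq in h3.
have h4 : (M + 1) * (rdot (T x) x - mu * rdot x x) <= (M + 1) * (e * rdot x x).
  by rewrite ler_wpM2l //; lra.
have := mulr_gt0 e0 xp; nra.
Qed.

Lemma op_bounds_le T (m M : R) :
  (forall x, m * rnm x <= rnm (T x) <= M * rnm x) -> m <= M.
Proof.
move=> h; have [x xn] := @hilbert_nonzero R H.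
have x0 : 0 < rnm x.
  by rewrite lt_def rnm_ge0 andbT; apply: contra_neq xn => /rnm_eq0.
by have /andP[h1 h2] := h x; rewrite -(ler_pM2r x0) (le_trans h1).
Qed.

(** This is [(T - m)(M - T) >= 0] in expanded form: [positive_below] makes [T - m] positive, and
    [positive_sq_le] with [d = M - m] applies to it. *)
Lemma kantorovich T (m M : R) : op_positive T -> 0 <= m ->
  (forall x, m * rnm x <= rnm (T x) <= M * rnm x) ->
  forall x, rnm (T x) ^+ 2 + m * M * rnm x ^+ 2 <= (m + M) * rdot (T x) x.
Proof.
move=> Tp m0 TmM x; have mM := op_bounds_le TmM.
have Tm := positive_below Tp (fun x => proj1 (andP (TmM x))).
have dM : 0 <= M - m by rewrite subr_ge0.
have := positive_sq_le dM (positive_sub Tp Tm) _ x.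
rewrite !opDE !opNE !opZE !op1E => /(_ _)/wrap[y|].
  rewrite !opDE !opNE !opZE !op1E rdotDl rdotNl rdotZl.
  by have := rdot_bound (proj2 (andP (TmM y))); lra.
rewrite !(rdotDl, rdotDr, rdotNl, rdotNr, rdotZl, rdotZr) !rnm_sq (rdotC x).
lra.
Qed.

Lemma kantorovich_sqrt T (m M : R) : op_positive T -> 0 < m ->
  (forall x, m * rnm x <= rnm (T x) <= M * rnm x) ->
  forall x, rnm (T x) * rnm x <= (m + M) / (2 * Num.sqrt (m * M)) * rdot (T x) x.
Proof.
move=> Tp m0 TmM x; have mM := op_bounds_le TmM.
have p : 0 < m * M by rewrite mulr_gt0 //; lra.
have s0 : 0 < Num.sqrt (m * M) by rewrite sqrtr_gt0.
have := kantorovich Tp (ltW m0) TmM x; rewrite -{1}(sqr_sqrtr (ltW p)).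
set s := Num.sqrt _ in s0 * => h; rewrite mulrAC ler_pdivlMr; last by rewrite mulr_gt0.
(* AM-GM for [|T x|] and [s |x|], with [s ^+ 2 = m * M]. *)
have := sqr_ge0 (rnm (T x) - s * rnm x); lra.
Qed.

End Positive.

(** * Positive square roots *)

(* Real-linear identities between vectors, by pairing with an arbitrary vector. *)
Ltac vec := apply: rdot_inj => ?; rewrite ?(rdotDr, rdotNr, rdotZr, rdot0r); lra.

Section SquareRoot.
Context {R : realType} {H : hilbertType R}.
Implicit Types (x y z : H) (S T : bounded_op H).

Lemma rnmZc (a : R[i]) x : rnm (a *: x) = complex.Re `|a| * rnm x.
Proof.
by rewrite /rnm normrZ !normE -[in LHS](RRe_real (normr_real a)) -rmorphM.
Qed.

(* [sqrt_iter B n] converges to [1 - sqrt (1 - B)] when [|B| <= 1]; [sqrt_coef]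
   is the scalar case [B = 1], whose increments dominate those of [sqrt_iter]. *)
Fixpoint sqrt_coef (n : nat) : R :=
  if n is n'.+1 then 2^-1 * (1 + sqrt_coef n' ^+ 2) else 0.

Fixpoint sqrt_iter (B : bounded_op H) (n : nat) : bounded_op H :=
  if n is n'.+1 then (2^-1)%:C *: (B + sqrt_iter B n' * sqrt_iter B n') else 0.

Lemma sqrt_iterS B n x : sqrt_iter B n.+1 x =
  (2^-1)%:C *: (B x + sqrt_iter B n (sqrt_iter B n x)).
Proof. by []. Qed.

Lemma opB T x y : T (x - y) = T x - T y.
Proof. by rewrite opD -scaleN1r opZ scaleN1r. Qed.

Lemma sqrt_coef_bounds n : 0 <= sqrt_coef n <= 1.
Proof. by elim: n => [|n /andP[IH1 IH2]] /=; apply/andP; split => //; nra. Qed.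

Lemma sqrt_coefS n : sqrt_coef n <= sqrt_coef n.+1.
Proof.
elim: n => [|n IH]; first by rewrite /= expr0n /=; lra.
have [/andP[h1 h2] /andP[h3 h4]] := (sqrt_coef_bounds n, sqrt_coef_bounds n.+1).
by rewrite [leLHS]/= [leRHS]/= -/(sqrt_coef n.+1) ler_pM2l ?invr_gt0 // lerD2l ler_sqr.
Qed.

Lemma sqrt_coef_mono m n : (m <= n)%N -> sqrt_coef m <= sqrt_coef n.
Proof. exact: (homo_leq (@lexx _ R) (@le_trans _ R) sqrt_coefS). Qed.

Lemma sqrt_coef_cauchy (e : R) : 0 < e -> exists N, forall m n,
  (N <= m)%N -> (N <= n)%N -> `|sqrt_coef m - sqrt_coef n| < e.
Proof.
move=> e0; pose A := range sqrt_coef.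
have As : has_sup A.
  split; first by exists 0; exists 0%N.
  by exists 1 => _ [n _ <-]; have /andP[] := sqrt_coef_bounds n.
have [_ [N _ <-] hN] := sup_adherent e0 As; exists N => m n Nm Nn.
have le_sup k : sqrt_coef k <= sup A by apply: ub_le_sup As.2 _ _; exists k.
have := le_sup m; have := le_sup n.
have := sqrt_coef_mono Nm; have := sqrt_coef_mono Nn.
by rewrite ltr_norml => *; apply/andP; split; lra.
Qed.

(** * Norm convergence of the square root iteration *)

Section Iteration.
Variable B : bounded_op H.
Hypothesis B1 : forall x, rnm (B x) <= rnm x.

Lemma sqrt_iter_bound n x : rnm (sqrt_iter B n x) <= sqrt_coef n * rnm x.
Proof.
elim: n x => [|n IH] x; first by rewrite mul0r rnm0.
rewrite sqrt_iterS rnmZ ger0_norm ?invr_ge0// -mulrA ler_wpM2l ?invr_ge0//.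
apply: le_trans (rnmD _ _) _; rewrite mulrDl mul1r lerD ?B1//.
apply: le_trans (IH _) _; rewrite expr2 -mulrA ler_wpM2l //.
by have /andP[] := sqrt_coef_bounds n.
Qed.

Lemma sqrt_iter_step n x : rnm (sqrt_iter B n.+1 x - sqrt_iter B n x) <=
  (sqrt_coef n.+1 - sqrt_coef n) * rnm x.
Proof.
elim: n x => [|n IH] x.
  rewrite (_ : sqrt_iter B 0 x = 0)// (_ : sqrt_coef 0 = 0)// !subr0.
  exact: sqrt_iter_bound.
set U := sqrt_iter B n.+1; set V := sqrt_iter B n.
set u := sqrt_coef n.+1; set v := sqrt_coef n.
(* The factorisation [U^2 - V^2 = U (U - V) + (U - V) V] holds without commutation; the scalar
   increment is split in the same way, so the two sides compare term by term. *)
have -> : sqrt_iter B n.+2 x - U x = (2^-1)%:C *: (U ((U - V) x) + (U - V) (V x)).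
  have Ux : U x = (2^-1)%:C *: (B x + V (V x)) by [].
  by rewrite sqrt_iterS -/U [X in _ - X]Ux !opDE !opNE opB; vec.
have -> : sqrt_coef n.+2 - u = 2^-1 * (u * (u - v) + (u - v) * v).
  have uv : u = 2^-1 * (1 + v ^+ 2) by [].
  have u2 : sqrt_coef n.+2 = 2^-1 * (1 + u ^+ 2) by [].
  by rewrite u2 [X in _ - X]uv; ring.
rewrite rnmZ ger0_norm ?invr_ge0// -mulrA ler_wpM2l ?invr_ge0// mulrDl.
have /andP[u0 _] := sqrt_coef_bounds n.+1.
apply: le_trans (rnmD _ _) _; apply: lerD.
  apply: le_trans (sqrt_iter_bound _ _) _; rewrite -mulrA ler_wpM2l //.
  by rewrite opDE opNE.
rewrite opDE opNE; apply: le_trans (IH _) _; rewrite -mulrA ler_wpM2l //.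
  by rewrite subr_ge0 sqrt_coefS.
exact: sqrt_iter_bound.
Qed.

Lemma sqrt_iter_dist m n x : (n <= m)%N ->
  rnm (sqrt_iter B m x - sqrt_iter B n x) <= (sqrt_coef m - sqrt_coef n) * rnm x.
Proof.
move=> /subnK <-; elim: (m - n)%N => [|k IH]; first by rewrite add0n !subrr mul0r rnm0.
rewrite addSn.
have -> : sqrt_iter B (k + n).+1 x - sqrt_iter B n x =
  (sqrt_iter B (k + n).+1 x - sqrt_iter B (k + n) x) +
  (sqrt_iter B (k + n) x - sqrt_iter B n x) by rewrite addrA subrK.
apply: le_trans (rnmD _ _) _.
by have := sqrt_iter_step (k + n) x; move: IH; lra.
Qed.

(** The scalar sequence bounds the iterates' differences uniformly on the unit ball; completeness
    gives pointwise limits, and the uniform rate survives the passage to the limit. It is this rate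
    that transfers linearity, the norm bound and the fixed-point equation to [f]. *)
Lemma sqrt_iter_lim : exists f : H -> H, forall e : R, 0 < e ->
  exists N, forall n, (N <= n)%N -> forall x, rnm (sqrt_iter B n x - f x) <= e * rnm x.
Proof.
have dist (e : R) : 0 < e -> exists N, forall m n, (N <= m)%N -> (N <= n)%N ->
    forall x, rnm (sqrt_iter B m x - sqrt_iter B n x) <= e * rnm x.
  move=> e0; have [N hN] := sqrt_coef_cauchy e0; exists N => m n Nm Nn x.
  wlog mn : m n Nm Nn / (n <= m)%N.
    by move=> h; have [/h|/ltnW/h] := leqP n m; [exact|rewrite rnmBC; exact].
  apply: le_trans (sqrt_iter_dist _ mn) _; rewrite ler_wpM2r ?rnm_ge0//.
  by apply/ltW; apply: le_lt_trans (ler_norm _) (hN _ _ Nm Nn).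
have lim x : exists l, forall e : R, 0 < e -> exists N, forall n, (N <= n)%N ->
    rnm (sqrt_iter B n x - l) < e.
  apply: hilbert_cauchy => e e0; have p := rnm_ge0 x.
  have d0 : 0 < e / (rnm x + 1) by rewrite divr_gt0 //; lra.
  have [N hN] := dist _ d0; exists N => m n Nm Nn.
  apply: le_lt_trans (hN _ _ Nm Nn x) _.
  by rewrite mulrAC ltr_pdivrMr; nra.
have /choice[f fP] := lim; exists f => e e0.
have [N hN] := dist e e0; exists N => n Nn x.
(* The index [maxn N K], with [K] depending on [x], serves only as an intermediate point; its cost
   [d] is arbitrary. *)
apply/ler_addgt0Pr => d d0; have [K hK] := fP x d d0.
have := hN _ _ Nn (leq_maxl N K) x; have := hK _ (leq_maxr N K).
set k := maxn N K => h1 h2.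
have -> : sqrt_iter B n x - f x = (sqrt_iter B n x - sqrt_iter B k x) +
  (sqrt_iter B k x - f x) by rewrite addrA subrK.
by apply: le_trans (rnmD _ _) _; lra.
Qed.

Lemma vanish_eq0 (x : H) (C : R) : (forall e : R, 0 < e -> rnm x <= e * C) -> x = 0.
Proof.
move=> h; apply: rnm_eq0; have x0 := rnm_ge0 x.
have := h 1 ltr01; rewrite mul1r => xC.
have [//|xp] : rnm x = 0 \/ 0 < rnm x by move: x0; rewrite le_eqVlt => /orP[/eqP|]; auto.
have Cp : 0 < C by lra.
(* This choice of [e] bounds [rnm x] by half of itself. *)
have := h (rnm x / (2 * C)); rewrite divr_gt0 ?mulr_gt0// => /(_ isT).
suff -> : rnm x / (2 * C) * C = rnm x / 2 by lra.
by field; lra.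
Qed.

(** [Y] is the limit of the iteration; its fixed-point equation says [(1 - Y)^2 = 1 - B]. *)
Lemma sqrt_one_minus : selfadj B -> exists Y : bounded_op H,
  [/\ selfadj Y, forall x, rnm (Y x) <= rnm x &
      Y = (2^-1)%:C *: (B + Y * Y)].
Proof.
move=> Bs; have [f fP] := sqrt_iter_lim.
have Ys n : selfadj (sqrt_iter B n).
  elim: n => [|n IH] x y; first by rewrite rdot0l rdot0r.
  by rewrite !sqrt_iterS rdotZl rdotZr rdotDl rdotDr Bs !IH.
have lf : linear f.
  move=> a x y; apply/eqP; rewrite -subr_eq0; apply/eqP.
  apply: (@vanish_eq0 _ (rnm (a *: x + y) + (complex.Re `|a| * rnm x + rnm y))) => e e0.
  have [N hN] := fP e e0; have {hN} h := hN N (leqnn N).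
  set Y := sqrt_iter B N in h.
  have -> : f (a *: x + y) - (a *: f x + f y) =
     - (Y (a *: x + y) - f (a *: x + y)) + (a *: (Y x - f x) + (Y y - f y)).
    by rewrite opD opZ scalerBr; vec.
  have h1 := h (a *: x + y); have h2 := h x; have h3 := h y.
  apply: le_trans (rnmD _ _) _; rewrite rnmN mulrDr lerD//.
  apply: le_trans (rnmD _ _) _; rewrite mulrDr lerD// rnmZc mulrCA.
  rewrite ler_wpM2l//.
  by have := normr_ge0 a; rewrite lecE => /andP[].
have fb x : rnm (f x) <= 1 * rnm x.
  rewrite mul1r; apply/ler_addgt0Pr => d d0; have p := rnm_ge0 x.
  have e0 : 0 < d / (rnm x + 1) by rewrite divr_gt0 //; lra.
  have [N hN] := fP _ e0; have {hN} h := hN N (leqnn N) x.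
  have h2 := sqrt_iter_bound N x; have /andP[_ h3] := sqrt_coef_bounds N.
  have h4 : d / (rnm x + 1) * rnm x <= d by rewrite mulrAC ler_pdivrMr; nra.
  have := rnmB (sqrt_iter B N x) (sqrt_iter B N x - f x).
  by rewrite subKr; nra.
have [Y Yf] := bounded_op_exists lf fb.
have {}fP (e : R) : 0 < e -> exists N, forall n, (N <= n)%N ->
    forall x, rnm (sqrt_iter B n x - Y x) <= e * rnm x.
  by move=> /fP[N hN]; exists N => n Nn x; rewrite Yf; apply: hN.
exists Y; split => [x y|x|].
- apply/eqP; rewrite -subr_eq0 -normr_le0; apply/ler_addgt0Pr => d d0; rewrite add0r.
  have p := rnm_ge0 x; have q := rnm_ge0 y; have pq := mulr_ge0 p q.
  (* Each of the two pairings below has error at most [e |x| |y|]; the added 1 keeps the denominator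
     positive. *)
  have e0 : 0 < d / (2 * (rnm x * rnm y) + 1) by rewrite divr_gt0 //; lra.
  have [N hN] := fP _ e0; have {hN} h := hN N (leqnn N).
  have -> : rdot (Y x) y - rdot x (Y y) =
      rdot x (sqrt_iter B N y - Y y) - rdot (sqrt_iter B N x - Y x) y.
    by rewrite rdotDl rdotDr rdotNl rdotNr Ys; lra.
  have h1 := rdot_cs_abs x (sqrt_iter B N y - Y y).
  have h2 := rdot_cs_abs (sqrt_iter B N x - Y x) y.
  have h3 := ler_wpM2l p (h y); have h4 := ler_wpM2r q (h x).
  apply: le_trans (ler_normB _ _) _.
  have : d / (2 * (rnm x * rnm y) + 1) * (2 * (rnm x * rnm y) + 1) = d by field; lra.
  move: (d / _) e0 h3 h4 => e e0 h3 h4 de; nra.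
- by rewrite Yf -[leRHS]mul1r.
apply: bounded_op_ext => x; apply/eqP; rewrite -subr_eq0; apply/eqP.
(* The residual is one error of the next iterate plus half of two errors of the current one, each at
   most [e |x|]. *)
apply: (@vanish_eq0 _ (2 * rnm x)) => e e0.
have [N hN] := fP e e0.
have h1 := hN _ (leqnSn N) x; have h2 := hN _ (leqnn N).
set Z := sqrt_iter B N in h2.
have -> : Y x - ((2^-1)%:C *: (B + Y * Y)) x =
   - (sqrt_iter B N.+1 x - Y x) + (2^-1)%:C *: (Z (Z x - Y x) + (Z (Y x) - Y (Y x))).
  rewrite sqrt_iterS -/Z !opZE !opDE !opME opB; vec.
apply: le_trans (rnmD _ _) _; rewrite rnmN rnmZ ger0_norm ?invr_ge0//.
have h3 := rnmD (Z (Z x - Y x)) (Z (Y x) - Y (Y x)).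
have h4 := h2 (Y x); have h5 := sqrt_iter_bound N (Z x - Y x); have h6 := h2 x.
have /andP[c0 c1] := sqrt_coef_bounds N; have h7 := fb x; rewrite -Yf mul1r in h7.
have h8 := rnm_ge0 (Z x - Y x); have h9 := ler_wpM2l (ltW e0) h7.
have h10 : sqrt_coef N * rnm (Z x - Y x) <= rnm (Z x - Y x) by nra.
rewrite -/Z in h5; lra.
Qed.

End Iteration.

(** Rescaling puts [B = 1 - T / (M + 1)] between 0 and 1, and [sqrt (M + 1) (1 - Y)] is then a root
    of [T], positive because [|Y x| <= |x|]. *)
Lemma sqrt_exists T : op_positive T -> exists S, op_positive S /\ S * S = T.
Proof.
move=> Tp; have [M M0 TM] := op_bound T.
have Ts := positive_selfadj Tp.
have k0 : 0 < M + 1 by lra.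
pose B : bounded_op H := 1 - ((M + 1)^-1)%:C *: T.
have BE x : B x = x - ((M + 1)^-1)%:C *: T x by [].
have Bs : selfadj B.
  by move=> x y; rewrite !BE rdotDl rdotDr rdotNl rdotNr rdotZl rdotZr Ts.
have Bp : op_positive B.
  apply: selfadj_positive => // x; rewrite BE rdotDl rdotNl rdotZl subr_ge0.
  rewrite ler_pdivrMl//; apply: le_trans (rdot_bound (TM x)) _.
  by rewrite ler_wpM2r// -?rnm_sq ?sqr_ge0//; lra.
have Bid x : rdot (B x) x <= 1 * rdot x x.
  rewrite BE rdotDl rdotNl rdotZl mul1r gerBl mulr_ge0 ?positive_rdot// invr_ge0 ltW//.
(* From [B^2 <= B <= 1]. *)
have B1 x : rnm (B x) <= rnm x.
  apply: rnm_le (rnm_ge0 x) _; rewrite rnm_sq.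
  by have := positive_sq_le ler01 Bp Bid x; have := Bid x; lra.
have [Y [Ys Y1 YE]] := sqrt_one_minus B1 Bs.
pose s := Num.sqrt (M + 1); have ss : s ^+ 2 = M + 1 by rewrite sqr_sqrtr // ltW.
have s0 : 0 <= s by exact: sqrtr_ge0.
pose S : bounded_op H := s%:C *: (1 - Y).
have SE x : S x = s%:C *: (x - Y x) by [].
exists S; split.
  apply: selfadj_positive => [x y|x]; rewrite !SE.
    by rewrite rdotZl rdotZr rdotDl rdotDr rdotNl rdotNr Ys.
  rewrite rdotZl mulr_ge0// rdotDl rdotNl subr_ge0.
  by have := @rdot_bound _ _ Y 1 x; rewrite !mul1r; apply.
apply: bounded_op_ext => x; rewrite opME SE SE opZ -scalerBr scalerA -rmorphM -expr2 ss.
have YY : Y (Y x) = Y x + Y x - B x.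
  apply: rdot_inj => w; have := congr1 (fun Z : bounded_op H => rdot w (Z x)) YE.
  by rewrite opZE opDE opME !(rdotDr, rdotNr, rdotZr); lra.
have -> : T x = (M + 1)%:C *: (x - B x).
  by rewrite BE subKr scalerA -rmorphM divff ?scale1r // gt_eqF.
by rewrite opB YY; vec.
Qed.

End SquareRoot.

(** * The moduli and the upper bound *)

Section Moduli.
Context {R : realType} {H : hilbertType R}.
Implicit Types (x y z : H) (S T A : bounded_op H).

Lemma op_sqrtP T : op_positive T -> op_positive (op_sqrt T) /\ op_sqrt T * op_sqrt T = T.
Proof.
by move=> /sqrt_exists[S ST]; rewrite /op_sqrt; case: xgetP => [S' _ //|/(_ S)].
Qed.

Lemma op_sqrt_rnm T x : op_positive T -> rnm (op_sqrt T x) ^+ 2 = rdot (T x) x.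
Proof.
by case/op_sqrtP => p e; rewrite rnm_sq -(positive_selfadj p) -opME e.
Qed.

Lemma adjointM_rdot T x : rdot ((adjoint T * T) x) x = rnm (T x) ^+ 2.
Proof. by rewrite opME rdotC -adjoint_rdot rnm_sq. Qed.

Lemma adjoint_mul_positive T : op_positive (adjoint T * T).
Proof.
apply: selfadj_positive => [x y|x]; last by rewrite adjointM_rdot sqr_ge0.
by rewrite !opME -adjoint_rdot rdotC -adjoint_rdot rdotC.
Qed.

Lemma mul_adjoint_positive T : op_positive (T * adjoint T).
Proof. by have := adjoint_mul_positive (adjoint T); rewrite adjointK. Qed.

Lemma op_absP T : op_positive (op_abs T).
Proof. exact: (op_sqrtP (adjoint_mul_positive T)).1. Qed.

Lemma op_abs_rnm T x : rnm (op_abs T x) = rnm (T x).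
Proof.
apply/eqP; rewrite -(@eqrXn2 _ 2) ?rnm_ge0// op_sqrt_rnm ?adjointM_rdot//.
exact: adjoint_mul_positive.
Qed.

Lemma op_qsym_sq_positive T :
  op_positive ((2^-1 : R[i]) *: (adjoint T * T + T * adjoint T)).
Proof.
move=> x; rewrite opZE opDE innerZl innerDl mulr_ge0 ?invr_ge0// addr_ge0//.
  exact: adjoint_mul_positive.
exact: mul_adjoint_positive.
Qed.

Lemma inv2E : (2^-1 : R[i]) = (2^-1)%:C.
Proof. by rewrite fmorphV rmorph_nat. Qed.

Lemma op_abs_qsymP T : op_positive (op_abs_qsym T).
Proof. exact: (op_sqrtP (op_qsym_sq_positive T)).1. Qed.

Lemma op_abs_qsym_rnm T x :
  rnm (op_abs_qsym T x) ^+ 2 = 2^-1 * (rnm (T x) ^+ 2 + rnm (adjoint T x) ^+ 2).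
Proof.
rewrite op_sqrt_rnm; last exact: op_qsym_sq_positive.
rewrite opZE opDE inv2E rdotZl rdotDl adjointM_rdot.
by have := adjointM_rdot (adjoint T) x; rewrite adjointK => ->.
Qed.

Lemma op_abs_symP T : op_positive (op_abs_sym T).
Proof.
by move=> x; rewrite opZE opDE innerZl innerDl mulr_ge0 ?invr_ge0// addr_ge0// op_absP.
Qed.

Lemma op_abs_sym_rdot T x : rdot (op_abs_sym T x) x =
  2^-1 * (rdot (op_abs T x) x + rdot (op_abs (adjoint T) x) x).
Proof. by rewrite opZE opDE inv2E rdotZl rdotDl. Qed.

Lemma modulusP k T : op_positive (modulus k T).
Proof. by case: k; [exact: op_absP|exact: op_abs_symP|exact: op_abs_qsymP]. Qed.

Lemma op_leP S T : op_positive S -> op_positive T ->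
  (forall x, rdot (S x) x <= rdot (T x) x) -> op_le S T.
Proof.
move=> /positive_selfadj Ss /positive_selfadj Ts ST.
apply: selfadj_positive => [x y|x]; rewrite !opDE !opNE rdotDl rdotNl.
  by rewrite rdotDr rdotNr Ss Ts.
by rewrite subr_ge0.
Qed.

Lemma op_le_rdot S T x : op_le S T -> rdot (S x) x <= rdot (T x) x.
Proof.
by move=> /positive_rdot/(_ x); rewrite opDE opNE rdotDl rdotNl subr_ge0.
Qed.

Lemma positive_sumZ (I : finType) (P : pred I) (c : I -> R) (S : I -> bounded_op H) :
  (forall i, 0 <= c i) -> (forall i, op_positive (S i)) ->
  op_positive (\sum_(i | P i) (c i)%:C *: S i).
Proof.
move=> c0 Sp x; apply: (big_ind (fun T : bounded_op H => 0 <= inner (T x) x)).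
- by rewrite -[X in inner X _](scale0r (0 : H)) innerZl mul0r.
- by move=> S1 S2 h1 h2; rewrite opDE innerDl addr_ge0.
- by move=> i _; rewrite opZE innerZl mulr_ge0// ?lecR//; apply: Sp.
Qed.

Lemma rdot_sumZ (I : finType) (P : pred I) (c : I -> R) (S : I -> bounded_op H) x :
  rdot ((\sum_(i | P i) (c i)%:C *: S i) x) x = \sum_(i | P i) c i * rdot (S i x) x.
Proof.
by rewrite op_sumE rdot_suml; apply: eq_bigr => i _; rewrite opZE rdotZl.
Qed.

(** * The operator norm and the condition number *)

Lemma op_norm_has_sup T : has_sup [set complex.Re `|T x| | x in [set x : H | `|x| <= 1]].
Proof.
have [M M0 TM] := op_bound T; split; first by exists (rnm (T 0)), 0 => //=; rewrite normr0.
exists M => _ [x /= x1 <-]; rewrite -/(rnm _) (le_trans (TM _)) //.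
by move: x1; rewrite normE lecR => /(ler_wpM2l M0); rewrite mulr1.
Qed.

Lemma op_norm_bound T x : rnm (T x) <= op_norm T * rnm x.
Proof.
have [x0|x0] := eqVneq (rnm x) 0.
  by rewrite x0 (rnm_eq0 x0) -(scale0r (0 : H)) opZ scale0r rnm0 mulr0.
have xp : 0 < rnm x by rewrite lt_def x0 rnm_ge0.
rewrite -ler_pdivrMr// mulrC.
have -> : (rnm x)^-1 * rnm (T x) = rnm (T ((rnm x)^-1%:C *: x)).
  by rewrite opZ rnmZ ger0_norm // invr_ge0 ltW.
apply: ub_le_sup (op_norm_has_sup T).2 _ _.
exists ((rnm x)^-1%:C *: x) => //=.
by rewrite normE lecR rnmZ ger0_norm ?mulVf // invr_ge0 ltW.
Qed.

Lemma op_norm_ge0 T : 0 <= op_norm T.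
Proof.
apply: le_trans (ub_le_sup (op_norm_has_sup T).2 _); first exact: (rnm_ge0 (T 0)).
by exists 0 => //=; rewrite normr0.
Qed.

Lemma op_norm_le T (M : R) : (forall x, rnm (T x) <= M * rnm x) -> op_norm T <= M.
Proof.
move=> TM; have [x0 x0n] := @hilbert_nonzero R H.
(* Here the existence of a nonzero vector matters. *)
have M0 : 0 <= M.
  have := TM x0; have := rnm_ge0 (T x0).
  have : 0 < rnm x0 by rewrite lt_def rnm_ge0 andbT; apply: contra_neq x0n => /rnm_eq0.
  nra.
apply: ge_sup; first exact: (op_norm_has_sup T).1.
move=> _ [x /= x1 <-]; rewrite -/(rnm _) (le_trans (TM _)) //.
by move: x1; rewrite normE lecR => /(ler_wpM2l M0); rewrite mulr1.
Qed.

Lemma rnm_ge1_unit S T : S * T = 1 -> forall x, rnm x <= op_norm S * rnm (T x).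
Proof.
move=> ST x; have := op_norm_bound S (T x); rewrite -opME ST.
exact.
Qed.

Lemma op_norm_unit_gt0 S T : S * T = 1 -> 0 < op_norm S.
Proof.
move=> ST; have [x xn] := @hilbert_nonzero R H.
have xp : 0 < rnm x by rewrite lt_def rnm_ge0 andbT; apply: contra_neq xn => /rnm_eq0.
have := rnm_ge1_unit ST x; have := op_norm_ge0 S; rewrite le_eqVlt.
by move=> /orP[/eqP <-|//]; rewrite mul0r; lra.
Qed.

Section ConditionNumber.
Variable A : bounded_op H.
Hypothesis Au : A \is a GRing.unit.
Let M := op_norm A.
Let m := (op_norm A^-1)^-1.

Lemma unit_bounds x : m * rnm x <= rnm (A x) <= M * rnm x.
Proof.
rewrite op_norm_bound andbT ler_pdivrMl; first exact: rnm_ge1_unit (mulVr Au) x.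
exact: op_norm_unit_gt0 (mulVr Au).
Qed.

Lemma unit_adjoint_bounds x : m * rnm x <= rnm (adjoint A x) <= M * rnm x.
Proof.
apply/andP; split; last by apply: adjoint_bound; [exact: op_norm_ge0|exact: op_norm_bound].
rewrite ler_pdivrMl; last exact: op_norm_unit_gt0 (mulVr Au).
(* The adjoint of [A^-1] is a left inverse of [adjoint A] and obeys the same norm bound as
   [A^-1]. *)
have e : adjoint A^-1 * adjoint A = 1 by rewrite -adjointM (mulrV Au) adjoint1.
have := adjoint_bound (op_norm_ge0 A^-1) (op_norm_bound A^-1) (adjoint A x).
by rewrite -opME e.
Qed.

(** The condition number is [M / m]; multiplying numerator and denominator of the coefficient by [m]
    gives the constant of [kantorovich_sqrt]. *)
Lemma kappa_coefE : kappa_coef (cond_number A) = (m + M) / (2 * Num.sqrt (m * M)).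
Proof.
have N0 := op_norm_unit_gt0 (mulVr Au); have M0 := op_norm_unit_gt0 (mulrV Au).
rewrite /kappa_coef /cond_number -/M /m; set N := op_norm _ in N0 *.
have p : 0 < M * N by rewrite mulr_gt0.
have s0 : 0 < Num.sqrt (M * N) by rewrite sqrtr_gt0.
have -> : Num.sqrt (N^-1 * M) = Num.sqrt (M * N) / N.
  rewrite (_ : N^-1 * M = M * N / N ^+ 2); last by field; lra.
  by rewrite sqrtrM ?(ltW p)// sqrtrV ?sqr_ge0// sqrtr_sqr gtr0_norm.
by field; rewrite !gt_eqF.
Qed.

Lemma kappa_coef_ge0 : 0 <= kappa_coef (cond_number A).
Proof.
rewrite /kappa_coef divr_ge0 ?mulr_ge0 ?sqrtr_ge0//.
by rewrite addr_ge0 // mulr_ge0 ?op_norm_ge0.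
Qed.

Lemma kappa_coef_bound S : op_positive S ->
  (forall x, m * rnm x <= rnm (S x) <= M * rnm x) ->
  forall x, rnm (S x) * rnm x <= kappa_coef (cond_number A) * rdot (S x) x.
Proof.
move=> Sp SmM x; rewrite kappa_coefE; apply: kantorovich_sqrt => //.
by rewrite invr_gt0; exact: op_norm_unit_gt0 (mulVr Au).
Qed.

Lemma kappa_coef_abs x :
  rnm (A x) * rnm x <= kappa_coef (cond_number A) * rdot (op_abs A x) x.
Proof.
rewrite -op_abs_rnm; apply: kappa_coef_bound; first exact: op_absP.
by move=> y; rewrite op_abs_rnm unit_bounds.
Qed.

Lemma kappa_coef_abs_adjoint x : rnm (adjoint A x) * rnm x <=
  kappa_coef (cond_number A) * rdot (op_abs (adjoint A) x) x.
Proof.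
rewrite -op_abs_rnm; apply: kappa_coef_bound; first exact: op_absP.
by move=> y; rewrite op_abs_rnm unit_adjoint_bounds.
Qed.

(** The square of [|S y|], for [S] the quadratic modulus, is the mean of [|A y|^2] and
    [|adjoint A y|^2], both between [m^2 |y|^2] and [M^2 |y|^2]. *)
Lemma kappa_coef_qsym x : rnm (op_abs_qsym A x) * rnm x <=
  kappa_coef (cond_number A) * rdot (op_abs_qsym A x) x.
Proof.
apply: kappa_coef_bound; first exact: op_abs_qsymP.
move=> y; have := op_abs_qsym_rnm A y.
have /andP[a1 a2] := unit_bounds y; have /andP[b1 b2] := unit_adjoint_bounds y.
have m0 : 0 <= m by rewrite invr_ge0 op_norm_ge0.
have M0 : 0 <= M by exact: op_norm_ge0.
move: (rnm (A y)) (rnm (adjoint A y)) (rnm_ge0 (A y)) (rnm_ge0 (adjoint A y)) a1 a2 b1 b2.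
move=> a b a0 b0 a1 a2 b1 b2 e; have y0 := rnm_ge0 y.
have q0 := rnm_ge0 (op_abs_qsym A y).
have my : 0 <= m * rnm y by rewrite mulr_ge0.
have My : 0 <= M * rnm y by rewrite mulr_ge0.
by apply/andP; split; rewrite -ler_sqr ?nnegrE// e; nra.
Qed.

End ConditionNumber.

(** The coefficients stay abstract so that the family of adjoints can be treated with the condition
    numbers of the original operators. *)
Lemma op_abs_sum_le (I : finType) (F : I -> bounded_op H) (c : I -> R) x :
  (forall i, rnm (F i x) * rnm x <= c i * rdot (op_abs (F i) x) x) ->
  rdot (op_abs (\sum_i F i) x) x <= \sum_i c i * rdot (op_abs (F i) x) x.
Proof.
move=> Fc; apply: le_trans (rdot_cs _ _) _; rewrite op_abs_rnm op_sumE.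
apply: le_trans (ler_wpM2r (rnm_ge0 x) (rnm_sum _ _ _)) _.
by rewrite mulr_suml ler_sum.
Qed.

(** Minkowski's inequality: expand the square of the left side linearly in its first factor, bound
    each summand by Cauchy-Schwarz for pairs, and divide by the left side. *)
Lemma op_abs_qsym_rnm_sum (I : finType) (F : I -> bounded_op H) x :
  rnm (op_abs_qsym (\sum_i F i) x) <= \sum_i rnm (op_abs_qsym (F i) x).
Proof.
set T := \sum_i _; have qT := op_abs_qsym_rnm T x.
have := rnm_ge0 (op_abs_qsym T x); rewrite le_eqVlt => /orP[/eqP <-|q0].
  by apply: sumr_ge0 => i _; exact: rnm_ge0.
rewrite -(ler_pM2r q0) -expr2 qT !rnm_sq.
have Tx : T x = \sum_i F i x by rewrite op_sumE.
have aTx : adjoint T x = \sum_i adjoint (F i) x by rewrite adjoint_sum op_sumE.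
rewrite [X in rdot X (T x)]Tx [X in rdot X (adjoint T x)]aTx !rdot_suml.
rewrite -big_split /= mulr_sumr mulr_suml.
apply: ler_sum => i _.
have qi := op_abs_qsym_rnm (F i) x.
have := rdot_cs (F i x) (T x); have := rdot_cs (adjoint (F i) x) (adjoint T x).
move: (rdot _ _) (rdot _ _) => u v.
move: qT qi (rnm_ge0 (op_abs_qsym (F i) x)) q0.
move: (rnm (F i x)) (rnm (T x)) (rnm (adjoint (F i) x)) (rnm (adjoint T x)).
move: (rnm (op_abs_qsym (F i) x)) (rnm (op_abs_qsym T x)) => p q a b c d eq ep p0 q0 h1 h2.
have pq : 0 <= p * q by rewrite mulr_ge0// ltW.
(* Cauchy-Schwarz in the plane, by Lagrange's identity with remainder [(a * d - b * c) ^+ 2]. *)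
have : `|2^-1 * (a * b + c * d)| <= p * q.
  by apply: ler_norm_sqr => //; rewrite [leRHS]exprMn eq ep;
     have := sqr_ge0 (a * d - b * c); nra.
by rewrite ler_norml => /andP[_ ?]; lra.
Qed.

Lemma modulus_sum_le k (m : nat) (F : 'I_m.+1 -> bounded_op H) :
  (forall i, F i \is a GRing.unit) ->
  op_le (modulus k (\sum_i F i))
        (\sum_i (kappa_coef (cond_number (F i)))%:C *: modulus k (F i)).
Proof.
move=> Fu; apply: op_leP => [||x]; first exact: modulusP.
  apply: positive_sumZ => i; [exact: kappa_coef_ge0|exact: modulusP].
rewrite rdot_sumZ; case: k => /=.
- by apply: op_abs_sum_le => i; exact: kappa_coef_abs.
- rewrite op_abs_sym_rdot adjoint_sum.
  have h1 := op_abs_sum_le (fun i => kappa_coef_abs (Fu i) x).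
  have h2 := op_abs_sum_le (fun i => kappa_coef_abs_adjoint (Fu i) x).
  apply: (@le_trans _ _ (2^-1 *
    (\sum_i kappa_coef (cond_number (F i)) * rdot (op_abs (F i) x) x +
    \sum_i kappa_coef (cond_number (F i)) * rdot (op_abs (adjoint (F i)) x) x))).
    by rewrite ler_pM2l ?invr_gt0// lerD.
  rewrite -big_split /= mulr_sumr; apply: ler_sum => i _.
  by rewrite op_abs_sym_rdot -mulrDr mulrCA.
- apply: le_trans (rdot_cs _ _) _.
  apply: le_trans (ler_wpM2r (rnm_ge0 x) (op_abs_qsym_rnm_sum _ _)) _.
  by rewrite mulr_suml; apply: ler_sum => i _; exact: kappa_coef_qsym.
Qed.

End Moduli.

(** * The Hilbert space C^2 *)

(* A record rather than [R[i] * R[i]], which already carries the sup norm. *)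
Record c2 (R : realType) := C2 { c2fst : R[i]; c2snd : R[i] }.

Section ComplexPlane.
Context {R : realType}.
Implicit Types x y z : c2 R.

Lemma c2_eq x y : c2fst x = c2fst y -> c2snd x = c2snd y -> x = y.
Proof. by case: x; case: y => a b c d /= -> ->. Qed.

Definition pair_of_c2 x := (c2fst x, c2snd x).
Definition c2_of_pair (p : R[i] * R[i]) := C2 p.1 p.2.
Lemma pair_of_c2K : cancel pair_of_c2 c2_of_pair.
Proof. by case. Qed.
HB.instance Definition _ := Choice.copy (c2 R) (can_type pair_of_c2K).

Definition c2_add x y := C2 (c2fst x + c2fst y) (c2snd x + c2snd y).
Definition c2_opp x := C2 (- c2fst x) (- c2snd x).
Definition c2_scale (a : R[i]) x := C2 (a * c2fst x) (a * c2snd x).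

Fact c2_addA : associative c2_add.
Proof. by move=> x y z; apply: c2_eq; rewrite /= addrA. Qed.
Fact c2_addC : commutative c2_add.
Proof. by move=> x y; apply: c2_eq; rewrite /= addrC. Qed.
Fact c2_add0 : left_id (C2 0 0) c2_add.
Proof. by move=> x; apply: c2_eq; rewrite /= add0r. Qed.
Fact c2_addN : left_inverse (C2 0 0) c2_opp c2_add.
Proof. by move=> x; apply: c2_eq; rewrite /= addNr. Qed.
HB.instance Definition _ :=
  GRing.isZmodule.Build (c2 R) c2_addA c2_addC c2_add0 c2_addN.

Fact c2_scaleA a b x : c2_scale a (c2_scale b x) = c2_scale (a * b) x.
Proof. by apply: c2_eq; rewrite /= mulrA. Qed.
Fact c2_scale1 : left_id 1 c2_scale.
Proof. by move=> x; apply: c2_eq; rewrite /= mul1r. Qed.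
Fact c2_scaleDr : right_distributive c2_scale +%R.
Proof. by move=> a x y; apply: c2_eq; rewrite /= mulrDr. Qed.
Fact c2_scaleDl x : {morph c2_scale^~ x : a b / a + b}.
Proof. by move=> a b; apply: c2_eq; rewrite /= mulrDl. Qed.
HB.instance Definition _ := GRing.Zmodule_isLmodule.Build R[i] (c2 R)
  c2_scaleA c2_scale1 c2_scaleDr c2_scaleDl.

Definition c2_inner x y := c2fst x * (c2fst y)^* + c2snd x * (c2snd y)^*.

Definition c2_sqnorm x : R := complex.Re (c2fst x) ^+ 2 + complex.Im (c2fst x) ^+ 2 +
  complex.Re (c2snd x) ^+ 2 + complex.Im (c2snd x) ^+ 2.

Definition c2_norm x : R[i] := (Num.sqrt (c2_sqnorm x))%:C.

Lemma c2_sqnorm_ge0 x : 0 <= c2_sqnorm x.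
Proof. by rewrite /c2_sqnorm !addr_ge0 ?sqr_ge0. Qed.

Lemma c2_inner_self x : c2_inner x x = (c2_sqnorm x)%:C.
Proof.
rewrite /c2_inner /c2_sqnorm; case: x => [[a b] [c d]] /=.
by apply/eqP; rewrite eq_complex /=; apply/andP; split; apply/eqP; ring.
Qed.

Fact c2_ler_normD x y : c2_norm (x + y) <= c2_norm x + c2_norm y.
Proof.
rewrite /c2_norm -rmorphD lecR; set u := Num.sqrt (c2_sqnorm x).
set v := Num.sqrt (c2_sqnorm y).
have u0 : 0 <= u by exact: sqrtr_ge0.
have v0 : 0 <= v by exact: sqrtr_ge0.
rewrite -[leRHS]ger0_norm ?addr_ge0// -sqrtr_sqr ler_wsqrtr//.
pose b := complex.Re (c2_inner x y).
(* The discriminant of this polynomial gives Cauchy-Schwarz, and its value at [t = 1] the triangle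
   inequality. *)
have xyE (t : R) : c2_sqnorm (x + t%:C *: y) =
    c2_sqnorm x + 2 * t * b + t ^+ 2 * c2_sqnorm y.
  rewrite /b /c2_inner /c2_sqnorm; case: x y {u v u0 v0 b} => [[? ?] [? ?]] [[? ?] [? ?]] /=.
  by ring.
have b_uv : b ^+ 2 <= (u * v) ^+ 2.
  rewrite exprMn !sqr_sqrtr ?c2_sqnorm_ge0//; apply: discriminant_le => t.
  by rewrite -xyE c2_sqnorm_ge0.
have := ler_norm_sqr (mulr_ge0 u0 v0) b_uv; rewrite ler_norml => /andP[_ buv].
have := xyE 1; rewrite scale1r => ->.
rewrite -(sqr_sqrtr (c2_sqnorm_ge0 x)) -(sqr_sqrtr (c2_sqnorm_ge0 y)) -/u -/v; nra.
Qed.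

Fact c2_normrZ (a : R[i]) x : c2_norm (a *: x) = `|a| * c2_norm x.
Proof.
rewrite /c2_norm normc_def -rmorphM -sqrtrM ?addr_ge0 ?sqr_ge0//; congr (Num.sqrt _)%:C.
rewrite /c2_sqnorm; case: a x => [? ?] [[? ?] [? ?]] /=; ring.
Qed.

Fact c2_normr0_eq0 x : c2_norm x = 0 -> x = 0.
Proof.
move=> /complexI/eqP; rewrite sqrtr_eq0 /c2_sqnorm; case: x => [[a b] [c d]] /= h.
have := (sqr_ge0 a, sqr_ge0 b, sqr_ge0 c, sqr_ge0 d) => -[[[a0 b0] c0] d0].
by apply: c2_eq; congr (_ +i* _); apply/eqP; rewrite -sqrf_eq0; apply/eqP; lra.
Qed.

HB.instance Definition _ := Lmodule_isNormed.Build R[i] (c2 R)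
  c2_ler_normD c2_normrZ c2_normr0_eq0.

(** A 1-Lipschitz map sends a Cauchy filter to a Cauchy filter, and [R] is complete; meant for the
    four real coordinates. *)
Lemma c2_coord (f : c2 R -> R) (F : set_system (c2 R)) : ProperFilter F ->
  (forall x y, `|f x - f y|%:C <= `|x - y|) -> cauchy F ->
  exists l, forall e : R, 0 < e -> \forall x \near F, `|f x - l| < e.
Proof.
move=> PF fL /cauchyP cF; have : cauchy (f @ F).
  apply: cauchy_exP => e e0; have [|x Fx] := cF e%:C; first by rewrite ltcR.
  exists (f x); apply: (@filterS _ F _ (ball x e%:C)) Fx => y; rewrite -!ball_normE /= => xy.
  by rewrite -ltcR (le_lt_trans (fL x y)).
move=> /cauchy_cvgP /cvg_ex[l /cvgrPdist_lt fl]; exists l => e e0.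
by apply: filterS (fl e e0) => x; rewrite distrC.
Qed.

Fact c2_complete (F : set_system (c2 R)) : ProperFilter F -> cauchy F -> cvg F.
Proof.
move=> PF cF.
have nE x y : `|x - y| = c2_norm (x - y) by [].
have sq x y : [/\ (complex.Re (c2fst x) - complex.Re (c2fst y)) ^+ 2 <= c2_sqnorm (x - y),
  (complex.Im (c2fst x) - complex.Im (c2fst y)) ^+ 2 <= c2_sqnorm (x - y),
  (complex.Re (c2snd x) - complex.Re (c2snd y)) ^+ 2 <= c2_sqnorm (x - y) &
  (complex.Im (c2snd x) - complex.Im (c2snd y)) ^+ 2 <= c2_sqnorm (x - y)].
  rewrite /c2_sqnorm; case: x y => [[a b] [c d]] [[a' b'] [c' d']] /=.
  have := (sqr_ge0 (a - a'), sqr_ge0 (b - b'), sqr_ge0 (c - c'), sqr_ge0 (d - d')).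
  by move=> [[[? ?] ?] ?]; split; lra.
have [|l1 h1] := @c2_coord (fun x => complex.Re (c2fst x)) F PF _ cF.
  by move=> x y; rewrite nE lecR -sqrtr_sqr ler_wsqrtr//; case: (sq x y).
have [|l2 h2] := @c2_coord (fun x => complex.Im (c2fst x)) F PF _ cF.
  by move=> x y; rewrite nE lecR -sqrtr_sqr ler_wsqrtr//; case: (sq x y).
have [|l3 h3] := @c2_coord (fun x => complex.Re (c2snd x)) F PF _ cF.
  by move=> x y; rewrite nE lecR -sqrtr_sqr ler_wsqrtr//; case: (sq x y).
have [|l4 h4] := @c2_coord (fun x => complex.Im (c2snd x)) F PF _ cF.
  by move=> x y; rewrite nE lecR -sqrtr_sqr ler_wsqrtr//; case: (sq x y).
apply/cvg_ex; exists (C2 (l1 +i* l2) (l3 +i* l4)); apply/fcvgrPdist_lt => e e0.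
have [r re] : exists r : R, e = r%:C by apply/complex_realP; apply: gtr0_real.
subst e; have r0 : 0 < r by rewrite -ltcR.
(* Four squared coordinates below [r ^+ 2 / 4] sum to less than [r ^+ 2]. *)
have d0 : 0 < r / 2 by lra.
apply: filterS (filterI (filterI (h1 _ d0) (h2 _ d0)) (filterI (h3 _ d0) (h4 _ d0))) => x.
rewrite nE ltcR -[X in _ -> _ < X](ger0_norm (ltW r0)) -sqrtr_sqr /c2_sqnorm.
case: x => [[a b] [c d]] /= [[]]; rewrite !ltr_norml => /andP[? ?] /andP[? ?].
move=> [/andP[? ?] /andP[? ?]].
have sm (u v : R) : - (r / 2) < v - u -> v - u < r / 2 -> (u - v) ^+ 2 < r ^+ 2 / 4.
  by move=> h h'; nra.
have := (sm l1 a, sm l2 b, sm l3 c, sm l4 d) => -[[[s1 s2] s3] s4].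
rewrite ltr_sqrt ?exprn_gt0//.
have {s1}s1 := s1 ltac:(assumption) ltac:(assumption).
have {s2}s2 := s2 ltac:(assumption) ltac:(assumption).
have {s3}s3 := s3 ltac:(assumption) ltac:(assumption).
have {s4}s4 := s4 ltac:(assumption) ltac:(assumption).
lra.
Qed.

HB.instance Definition _ := Uniform_isComplete.Build (c2 R) c2_complete.

Fact c2_inner_bilinear : bilinear_for
  (GRing.Scale.Law.clone _ _ *%R _)
  (GRing.Scale.Law.clone _ _ (@Num.conj R[i] \; *%R) _) c2_inner.
Proof.
split => [y|x] a u v; rewrite /c2_inner /=.
  by ring.
by rewrite !rmorphD !rmorphM; ring.
Qed.

HB.instance Definition _ := bilinear_isBilinear.Build R[i] (c2 R) (c2 R) R[i]
  (GRing.Scale.Law.clone _ _ *%R _)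
  (GRing.Scale.Law.clone _ _ (@Num.conj R[i] \; *%R) _) c2_inner c2_inner_bilinear.

Fact c2_inner_hermitian x y :
  c2_inner x y = (-1) ^+ false * Num.conj (c2_inner y x).
Proof.
rewrite expr0 mul1r -[Num.conj _]/((c2_inner y x)^*) /c2_inner.
case: x y => [[? ?] [? ?]] [[? ?] [? ?]] /=.
by apply/eqP; rewrite eq_complex /=; apply/andP; split; apply/eqP; ring.
Qed.

HB.instance Definition _ := isHermitianSesquilinear.Build R[i] (c2 R) false
  (@Num.conj R[i]) c2_inner c2_inner_hermitian.

Fact c2_inner_gt0 x : x != 0 -> 0 < c2_inner x x.
Proof.
move=> xn; rewrite c2_inner_self ltcR lt_def c2_sqnorm_ge0 andbT.
apply: contra_neq xn => x0; apply: c2_normr0_eq0.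
by rewrite /c2_norm x0 sqrtr0.
Qed.

HB.instance Definition _ := isDotProduct.Build R[i] (c2 R) c2_inner c2_inner_gt0.

Fact c2_inner_norm x : `|x| ^+ 2 = c2_inner x x.
Proof.
rewrite c2_inner_self; have -> : `|x| = c2_norm x by [].
by rewrite -rmorphXn sqr_sqrtr ?c2_sqnorm_ge0.
Qed.

Fact c2_nonzero : exists x : c2 R, x != 0.
Proof.
exists (C2 1 0); apply/eqP => /(congr1 (@c2fst R)) /=; apply/eqP/oner_neq0.
Qed.

HB.instance Definition _ := CompleteNormedModule_isHilbert.Build R (c2 R)
  c2_inner_norm c2_nonzero.

End ComplexPlane.

(** * The extremal example *)

Section SelfAdjoint.
Context {R : realType} {H : hilbertType R}.
Implicit Types (x y z v : H) (S T A : bounded_op H).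

Lemma modulus_selfadj k T : selfadj T -> modulus k T = op_abs T.
Proof.
move=> Ts; have aT : adjoint T = T by exact: adjoint_uniq.
have half S : (2^-1 : R[i]) *: (S + S) = S.
  by apply: bounded_op_ext => x; rewrite opZE opDE inv2E; vec.
by case: k => //=; rewrite /op_abs_sym /op_abs_qsym /op_abs !aT half.
Qed.

(* [w := |T| v - l v] satisfies [|T| w = - l w], so positivity forces [w = 0]. *)
Lemma op_abs_eigen T v (l : R) : selfadj T -> 0 < l ->
  T (T v) = (l ^+ 2)%:C *: v -> op_abs T v = l%:C *: v.
Proof.
move=> Ts l0 Tv; have aT : adjoint T = T by exact: adjoint_uniq.
have [Sp SS] := op_sqrtP (adjoint_mul_positive T); rewrite -/(op_abs T) in Sp SS.
set S := op_abs T in Sp SS *; have Sv : S (S v) = (l ^+ 2)%:C *: v.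
  by rewrite -opME SS aT.
have := positive_rdot Sp (S v - l%:C *: v).
rewrite opB opZ Sv.
have -> : (l ^+ 2)%:C *: v - l%:C *: S v = (- l)%:C *: (S v - l%:C *: v) by vec.
rewrite rdotZl -rnm_sq => h; have h0 := sqr_ge0 (rnm (S v - l%:C *: v)).
have : rnm (S v - l%:C *: v) ^+ 2 = 0 by nra.
by move=> /eqP; rewrite sqrf_eq0 => /eqP/rnm_eq0/eqP; rewrite subr_eq0 => /eqP.
Qed.

Lemma op_inv_uniq S T : S * T = 1 -> T * S = 1 -> T \is a GRing.unit /\ T^-1 = S.
Proof.
move=> ST TS; have Tu : T \is a GRing.unit by apply/unitrP; exists S.
by split => //; rewrite -[LHS]mul1r -ST -mulrA (mulrV Tu) mulr1.
Qed.

Lemma op_norm_eq T (c : R) x : (forall y, rnm (T y) <= c * rnm y) ->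
  x != 0 -> rnm (T x) = c * rnm x -> op_norm T = c.
Proof.
move=> Tc xn Tx; apply/eqP; rewrite eq_le (op_norm_le Tc) /=.
have xp : 0 < rnm x by rewrite lt_def rnm_ge0 andbT; apply: contra_neq xn => /rnm_eq0.
by rewrite -(ler_pM2r xp) -Tx op_norm_bound.
Qed.

End SelfAdjoint.

(** * Real symmetric 2 by 2 matrices acting on C^2 *)

Section RealSymmetric.
Context {R : realType}.
Implicit Types x y z : c2 R.

Lemma c2_rdotE x y : rdot x y =
  complex.Re (c2fst x) * complex.Re (c2fst y) + complex.Im (c2fst x) * complex.Im (c2fst y) +
  (complex.Re (c2snd x) * complex.Re (c2snd y) + complex.Im (c2snd x) * complex.Im (c2snd y)).
Proof.
have -> : rdot x y = complex.Re (c2_inner x y) by [].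
by rewrite /c2_inner; case: x y => [[? ?] [? ?]] [[? ?] [? ?]] /=; ring.
Qed.

(** The matrix with rows [(p, q)] and [(q, r)]. *)
Definition sym_fun (p q r : R) x : c2 R :=
  C2 (p%:C * c2fst x + q%:C * c2snd x) (q%:C * c2fst x + r%:C * c2snd x).

Lemma sym_op_exists p q r : exists T : bounded_op (c2 R), T =1 sym_fun p q r.
Proof.
(* With [K] the squared Frobenius norm, [|T x|^2 <= K |x|^2 <= (K + 1)^2 |x|^2]; this avoids a
   square root. *)
apply: (@bounded_op_exists _ _ _ (p ^+ 2 + 2 * q ^+ 2 + r ^+ 2 + 1)).
  by move=> a x y; apply: c2_eq => /=; ring.
move=> x; set K := p ^+ 2 + 2 * q ^+ 2 + r ^+ 2.
have K0 : 0 <= K.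
  by rewrite /K; have := (sqr_ge0 p, sqr_ge0 q, sqr_ge0 r) => -[[? ?] ?]; lra.
have K1 : 0 <= K + 1 by lra.
apply: rnm_le; first by apply: mulr_ge0 => //; exact: rnm_ge0.
rewrite exprMn rnm_sq.
have X0 : 0 <= rdot x x by rewrite -rnm_sq sqr_ge0.
apply: (@le_trans _ _ (K * rdot x x)); last by rewrite ler_wpM2r//; nra.
rewrite !c2_rdotE /K; case: x {X0} => [[a b] [c d]] /=.
have := (sqr_ge0 (p * c - q * a), sqr_ge0 (p * d - q * b),
  sqr_ge0 (q * c - r * a), sqr_ge0 (q * d - r * b)).
move=> [[[? ?] ?] ?]; lra.
Qed.

Definition sym_op p q r : bounded_op (c2 R) :=
  xget 0 [set T : bounded_op (c2 R) | T =1 sym_fun p q r].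

Lemma sym_opE p q r x : sym_op p q r x = sym_fun p q r x.
Proof.
rewrite /sym_op; case: xgetP => [T _ -> //|].
by have [T hT] := sym_op_exists p q r => /(_ T).
Qed.

Lemma sym_op_selfadj p q r : selfadj (sym_op p q r).
Proof.
move=> x y; rewrite !sym_opE !c2_rdotE.
by case: x y => [[? ?] [? ?]] [[? ?] [? ?]] /=; ring.
Qed.

Lemma sym_opD p q r p' q' r' :
  sym_op p q r + sym_op p' q' r' = sym_op (p + p') (q + q') (r + r').
Proof.
apply: bounded_op_ext => x; rewrite opDE !sym_opE.
by apply: c2_eq => /=; rewrite !rmorphD; ring.
Qed.

Definition diag_op (kappa : R) := sym_op kappa 0 1.
Definition swap_op (t : R) := sym_op 0 t 0.

Lemma diag_opE k x : diag_op k x = C2 (k%:C * c2fst x) (c2snd x).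
Proof. by rewrite sym_opE; apply: c2_eq => /=; rewrite ?rmorph0 ?rmorph1; ring. Qed.

Lemma swap_opE t x : swap_op t x = C2 (t%:C * c2snd x) (t%:C * c2fst x).
Proof. by rewrite sym_opE; apply: c2_eq => /=; rewrite rmorph0; ring. Qed.

Lemma swap_opM s t : s * t = 1 -> swap_op s * swap_op t = 1.
Proof.
move=> st; apply: bounded_op_ext => x; rewrite opME !swap_opE.
by apply: c2_eq; rewrite /= mulrA -rmorphM st mul1r.
Qed.

Lemma diag_opM s t : s * t = 1 -> diag_op s * diag_op t = 1.
Proof.
move=> st; apply: bounded_op_ext => x; rewrite opME !diag_opE.
by apply: c2_eq; rewrite //= mulrA -rmorphM st mul1r.
Qed.

Lemma swap_op_rnm t x : rnm (swap_op t x) = `|t| * rnm x.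
Proof.
apply/eqP; rewrite -(@eqrXn2 _ 2) ?rnm_ge0 ?mulr_ge0 ?rnm_ge0//.
rewrite exprMn real_normK ?num_real// !rnm_sq swap_opE !c2_rdotE; apply/eqP.
by case: x => [[? ?] [? ?]] /=; ring.
Qed.

Lemma swap_op_norm t : 0 < t -> op_norm (swap_op t) = t.
Proof.
move=> t0; have [x xn] := c2_nonzero (R := R).
by apply: (op_norm_eq (x := x)) => // [y|]; rewrite swap_op_rnm gtr0_norm.
Qed.

Lemma diag_op_norm k : 1 <= k -> op_norm (diag_op k) = k.
Proof.
move=> k1; have k0 : 0 <= k by lra.
apply: (op_norm_eq (x := C2 1 0 : c2 R)) => [y||].
- apply: rnm_le; first by rewrite mulr_ge0 ?rnm_ge0.
  rewrite exprMn rnm_sq diag_opE !c2_rdotE; case: y => [[a b] [c d]] /=.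
  have := (sqr_ge0 c, sqr_ge0 d) => -[c0 d0].
  have kk : 1 <= k ^+ 2 by nra.
  have := mulr_ge0 (_ : 0 <= k ^+ 2 - 1) (addr_ge0 c0 d0) => /(_ _)/wrap[|]; first by lra.
  by lra.
- by apply/eqP => /(congr1 (@c2fst R)) /=; apply/eqP/oner_neq0.
- rewrite -{2}(ger0_norm k0) -rnmZ; congr rnm; rewrite diag_opE.
  by apply: c2_eq; rewrite /= ?mulr0.
Qed.

Lemma diag_op_inv_norm k : 1 <= k -> op_norm (diag_op k^-1) = 1.
Proof.
move=> k1; have k0 : 0 < k by lra.
apply: (op_norm_eq (x := C2 0 1 : c2 R)) => [y||].
- apply: rnm_le; first by rewrite mulr_ge0 ?rnm_ge0.
  rewrite exprMn expr1n mul1r rnm_sq diag_opE !c2_rdotE; case: y => [[a b] [c d]] /=.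
  have i1 : k^-1 <= 1 by rewrite invf_le1.
  have i0 : 0 <= k^-1 by rewrite invr_ge0 ltW.
  move: (k^-1) i0 i1 => i i0 i1.
  have ii : 0 <= 1 - i ^+ 2 by nra.
  have := mulr_ge0 ii (addr_ge0 (sqr_ge0 a) (sqr_ge0 b)); lra.
- by apply/eqP => /(congr1 (@c2snd R)) /=; apply/eqP/oner_neq0.
- by rewrite mul1r; congr rnm; rewrite diag_opE; apply: c2_eq; rewrite /= ?mulr0.
Qed.

Lemma diag_op_unit k : 1 <= k ->
  diag_op k \is a GRing.unit /\ cond_number (diag_op k) = k.
Proof.
move=> k1; have k0 : k != 0 by apply/eqP; lra.
have [u e] := op_inv_uniq (diag_opM (mulVf k0)) (diag_opM (mulfV k0)).
by split => //; rewrite /cond_number e diag_op_norm// diag_op_inv_norm// mulr1.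
Qed.

Lemma swap_op_unit t : 0 < t ->
  swap_op t \is a GRing.unit /\ cond_number (swap_op t) = 1.
Proof.
move=> t0; have tn : t != 0 by rewrite gt_eqF.
have [u e] := op_inv_uniq (swap_opM (mulVf tn)) (swap_opM (mulfV tn)).
by split => //; rewrite /cond_number e !swap_op_norm ?invr_gt0// mulfV.
Qed.

Definition test_vec (k : R) : c2 R := C2 1 (Num.sqrt k)%:C.

(** The basis vectors are eigenvectors of the modulus with eigenvalues [k] and 1, and each
    contributes [k] to the form at [test_vec k]. *)
Lemma diag_abs_test k : 1 <= k ->
  rdot (op_abs (diag_op k) (test_vec k)) (test_vec k) = 2 * k.
Proof.
move=> k1; have k0 : 0 < k by lra.
pose e1 : c2 R := C2 1 0; pose e2 : c2 R := C2 0 1.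
have xe : test_vec k = e1 + (Num.sqrt k)%:C *: e2.
  by apply: c2_eq => /=; rewrite ?mulr0 ?mulr1 ?addr0 ?add0r.
have Se1 : op_abs (diag_op k) e1 = k%:C *: e1.
  apply: op_abs_eigen => //; first exact: sym_op_selfadj.
  by rewrite !diag_opE; apply: c2_eq; rewrite /= ?mulr0// rmorphXn mulrA expr2.
have Se2 : op_abs (diag_op k) e2 = 1%:C *: e2.
  apply: op_abs_eigen => //; first exact: sym_op_selfadj.
  by rewrite !diag_opE expr1n scale1r; apply: c2_eq; rewrite /= ?mulr0.
rewrite [in op_abs _ _]xe opD opZ Se1 Se2 c2_rdotE /=.
have := sqr_sqrtr (ltW k0); set s := Num.sqrt k => sk; rewrite -sk; ring.
Qed.

Lemma test_vec_sq k : 0 <= k -> rdot (test_vec k) (test_vec k) = 1 + k.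
Proof. by move=> k0; rewrite c2_rdotE /= -[in RHS](sqr_sqrtr k0); ring. Qed.

(** [swap_op t] squares to [t ^+ 2], so its modulus multiplies every vector by [t]. *)
Lemma swap_abs_test k t : 0 <= k -> 0 < t ->
  rdot (op_abs (swap_op t) (test_vec k)) (test_vec k) = t * (1 + k).
Proof.
move=> k0 t0; rewrite (op_abs_eigen (l := t)) ?rdotZl ?test_vec_sq//.
  exact: sym_op_selfadj.
by rewrite !swap_opE; apply: c2_eq; rewrite /= mulrA -rmorphM.
Qed.

(* With [h = (k + 1) / 2], the operator [diag_op k + swap_op t - h] is [rho] times
   an isometry; this provides the bounds [rho - h] and [rho + h] for [kantorovich]. *)
Lemma sum_abs_test (k t rho : R) : 1 <= k -> k <= t -> 0 <= rho ->
  rho ^+ 2 = t ^+ 2 + ((k - 1) / 2) ^+ 2 ->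
  (1 + k) * (t ^+ 2 + t * Num.sqrt k) <=
  rho * rdot (op_abs (diag_op k + swap_op t) (test_vec k)) (test_vec k).
Proof.
move=> k1 kt rho0 rhoE; set T : bounded_op (c2 R) := diag_op k + swap_op t.
pose h := (k + 1) / 2.
have k0 : 0 <= k by lra.
have h0 : 0 <= h by rewrite /h; lra.
have TE x : T x = sym_fun k t 1 x.
  by rewrite /T sym_opD sym_opE !(addr0, add0r).
have dist x : rnm (T x - h%:C *: x) = rho * rnm x.
  apply/eqP; rewrite -(@eqrXn2 _ 2) ?rnm_ge0 ?mulr_ge0 ?rnm_ge0//.
  rewrite exprMn rhoE !rnm_sq TE !c2_rdotE; apply/eqP.
  by rewrite /h; case: x => [[? ?] [? ?]] /=; field.
(* [h ^+ 2 = ((k - 1) / 2) ^+ 2 + k], and [k <= k ^+ 2 <= t ^+ 2]. *)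
have hrho : h <= rho.
  rewrite -ler_sqr ?nnegrE// rhoE /h; nra.
have bounds x : (rho - h) * rnm x <= rnm (op_abs T x) <= (rho + h) * rnm x.
  rewrite op_abs_rnm; have d := dist x.
  have hx : rnm (h%:C *: x) = h * rnm x by rewrite rnmZ ger0_norm.
  have h1 := rnmD (T x - h%:C *: x) (h%:C *: x); rewrite subrK d hx in h1.
  have h2 := rnmB (T x) (h%:C *: x); rewrite d hx in h2.
  by apply/andP; split; lra.
have m0 : 0 <= rho - h by lra.
have := kantorovich (op_absP T) m0 bounds (test_vec k).
rewrite op_abs_rnm !rnm_sq test_vec_sq//.
(* With [s = sqrt k], [T] sends [(1, s)] to [(t + s) (s, 1)]. *)
have -> : rdot (T (test_vec k)) (T (test_vec k)) = (1 + k) * (t + Num.sqrt k) ^+ 2.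
  rewrite TE c2_rdotE /=; have := sqr_sqrtr k0; set s := Num.sqrt k => sk; rewrite -sk; ring.
have -> : (rho - h) * (rho + h) = t ^+ 2 - k.
  rewrite (_ : (rho - h) * (rho + h) = rho ^+ 2 - h ^+ 2); last by ring.
  by rewrite rhoE /h; field.
have := sqr_sqrtr k0; set s := Num.sqrt k => sk.
have -> : (1 + k) * (t + s) ^+ 2 + (t ^+ 2 - k) * (1 + k) = 2 * ((1 + k) * (t ^+ 2 + t * s)).
  by rewrite -sk; ring.
lra.
Qed.

End RealSymmetric.

(** * Choice of the parameters and conclusion *)

Lemma kappa_coef1 (R : realType) : kappa_coef (1 : R) = 1.
Proof. by rewrite /kappa_coef sqrtr1; field. Qed.

(* With [b = (k - 1) / 2], [s = sqrt k] and [a' = 2 a k / (1 + k) < s], one has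
   [rho <= t + b ^ 2 / (2 t)], so [b ^ 2 < t (s - a')] and [|a'| <= t] suffice. *)
Lemma sharpness_parameter (R : realType) (k a : R) : 1 <= k -> a < kappa_coef k ->
  exists t rho : R, [/\ k <= t, 0 < rho, rho ^+ 2 = t ^+ 2 + ((k - 1) / 2) ^+ 2 &
    rho * (a * (2 * k) + t * (1 + k)) < (1 + k) * (t ^+ 2 + t * Num.sqrt k)].
Proof.
move=> k1 ak; set s := Num.sqrt k; set b := (k - 1) / 2.
have k0 : 0 < k by lra.
have s0 : 0 < s by rewrite sqrtr_gt0.
have ss : s ^+ 2 = k by rewrite sqr_sqrtr// ltW.
pose a' := 2 * a * k / (1 + k).
have a's : a' < s.
  rewrite /a' ltr_pdivrMr; last by lra.
  move: ak; rewrite /kappa_coef -/s ltr_pdivlMr ?mulr_gt0// => ak.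
  have := ltr_pM2r s0; move=> /(_ (a * (2 * s)) (k + 1)); rewrite ak => h.
  by rewrite -ss; rewrite -ss in h; lra.
(* The three summands secure [k <= t], [|a'| <= t] and [b ^+ 2 < t * (s - a')] respectively. *)
pose t := k + `|a'| + (b ^+ 2 + 1) / (s - a').
have d0 : 0 < (b ^+ 2 + 1) / (s - a').
  by rewrite divr_gt0 ?subr_gt0//; have := sqr_ge0 b; lra.
have na := normr_ge0 a'.
have tk : k <= t by rewrite /t; lra.
have t0 : 0 < t by lra.
have ta : `|a'| <= t by rewrite /t; lra.
have tb : b ^+ 2 + 1 <= t * (s - a').
  have -> : b ^+ 2 + 1 = (b ^+ 2 + 1) / (s - a') * (s - a') by field; lra.
  by rewrite ler_pM2r ?subr_gt0// /t; lra.
have p : 0 < t ^+ 2 + b ^+ 2 by rewrite ltr_wpDr ?sqr_ge0 ?exprn_gt0.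
exists t, (Num.sqrt (t ^+ 2 + b ^+ 2)); split => //.
- by rewrite sqrtr_gt0.
- by rewrite sqr_sqrtr// ltW.
set rho := Num.sqrt _.
have rho0 : 0 < rho by rewrite sqrtr_gt0.
have rho_le : 2 * t * rho <= 2 * t ^+ 2 + b ^+ 2.
  have : rho ^+ 2 = t ^+ 2 + b ^+ 2 by rewrite sqr_sqrtr// ltW.
  by have := sqr_ge0 (rho - t); lra.
have -> : a * (2 * k) + t * (1 + k) = (1 + k) * (a' + t) by rewrite /a'; field; lra.
rewrite mulrCA ltr_pM2l; last by lra.
have at0 : 0 <= a' + t.
  by move: ta; rewrite ler_norml => /andP[]; lra.
(* After multiplying by [2 t], the left side is at most [(2 t^2 + b^2)(a' + t) <= 2 t^2 (a' + t) + 2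
   t b^2], which is below [2 t^2 (t + s)]. *)
rewrite -(@ltr_pM2l _ (2 * t)) ?mulr_gt0// mulrA.
apply: le_lt_trans (ler_wpM2r at0 rho_le) _.
have a't : a' <= t by move: ta; rewrite ler_norml => /andP[].
have b0 := sqr_ge0 b.
have h1 : b ^+ 2 * (a' + t) <= b ^+ 2 * (2 * t) by rewrite ler_wpM2l//; lra.
have h2 : 2 * t * (b ^+ 2) < 2 * t * (t * (s - a')) by rewrite ltr_pM2l ?mulr_gt0//; lra.
lra.
Qed.

Theorem theorem1p17 (R : realType) (k : modulus_kind) :
  (forall (H : hilbertType R) (m : nat) (A : 'I_m.+1 -> bounded_op H),
     (forall i, A i \is a GRing.unit) ->
     op_le (modulus k (\sum_i A i))
           (\sum_i (kappa_coef (cond_number (A i)))%:C *: modulus k (A i)))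
  /\
  (forall kappa a : R, 1 <= kappa -> a < kappa_coef kappa ->
     exists (H : hilbertType R) (m : nat) (A : 'I_m.+1 -> bounded_op H),
       [/\ forall i, A i \is a GRing.unit,
           cond_number (A ord0) = kappa &
           ~ op_le (modulus k (\sum_i A i))
                   (a%:C *: modulus k (A ord0) +
                    \sum_(i | i != ord0)
                      (kappa_coef (cond_number (A i)))%:C *: modulus k (A i))]).
Proof.
split=> [H m A Au|kappa a kappa1 a_lt]; first exact: modulus_sum_le.
have [t [rho [kt rho0 rhoE lt]]] := sharpness_parameter kappa1 a_lt.
have t0 : 0 < t by lra.
have [Du Dk] := diag_op_unit kappa1; have [Wu Wk] := swap_op_unit t0.
(* The family is indexed by ['I_m.+1], so 1 stands for two operators. *)
exists (c2 R), 1%N, (fun i => if i == ord0 then diag_op kappa else swap_op t).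
split=> [i||]; [by case: ifP|by []|].
have -> : \sum_(i < 2) (if i == ord0 then diag_op kappa else swap_op t) =
    diag_op kappa + swap_op t by rewrite !big_ord_recl big_ord0 addr0.
rewrite big_mkcond !big_ord_recl big_ord0 /= addr0 add0r Wk kappa_coef1.
rewrite !modulus_selfadj; try exact: sym_op_selfadj; last first.
  by rewrite sym_opD; exact: sym_op_selfadj.
move=> /(op_le_rdot (test_vec kappa)).
have kappa0 : 0 <= kappa by exact: le_trans ler01 kappa1.
rewrite opDE !opZE rdotDl !rdotZl (diag_abs_test kappa1) (swap_abs_test kappa0 t0).
(* Multiplied by [rho], the assumed inequality at [test_vec kappa] joins the lower bound of
   [sum_abs_test] to the strict upper bound [lt]. *)
rewrite mul1r => le; have := sum_abs_test kappa1 kt (ltW rho0) rhoE.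
by move=> /le_trans/(_ (ler_wpM2l (ltW rho0) le))/le_lt_trans/(_ lt); rewrite ltxx.
Qed.
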